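(* Let $(M,g_{ab})$ be a (non-flat) hyper-Kähler Riemannian 4-manifold, with $R_{ab}=0$ and $\tilde\Psi_{A'B'C'D'}=0$, admitting a conformal Kähler structure of the opposite (anti-self-dual) orientation, given by a real unprimed Killing spinor $\sigma_{AB}$, $\nabla_{AA'}\sigma_{BC}=2\epsilon_{A(B}\xi_{C)A'}$, $\xi_a\neq0$. Suppose that the Killing vector $\xi^a$ is not anti-self-dual, i.e. $\chi_{A'B'}:=\frac12\nabla_{AA'}\xi^A_{B'}\neq0$. Define a symmetric tensor $H_{ab}$ and a vector field $t^a$ by $$H_{ab}:=\sigma_{AB}\chi_{A'B'}-\tfrac12\mathcal{E}_+g_{ab},\qquad t_a:=H_{ab}\xi^b,$$ where $\mathcal{E}_+:=\Omega_-+\xi_b\xi^b$. Then $$\nabla_{(a}H_{bc)}=0,\qquad\nabla_{(a}t_{b)}=0,\qquad\nabla_{AA'}t^A_{B'}=0,\qquad[t,\xi]=0.$$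
   Context: Penrose–Rindler 2-spinor notation, $g_{ab}=\epsilon_{AB}\epsilon_{A'B'}$; 2-forms $\phi_{A'B'}\epsilon_{AB}$ are self-dual (SD) and $\phi_{AB}\epsilon_{A'B'}$ anti-self-dual (ASD). $\tilde\Psi_{A'B'C'D'}$ and $\Psi_{ABCD}$ are the SD and ASD Weyl spinors, and $\dagger$ is Euclidean spinor conjugation (real means invariant under $\dagger$). A conformal Kähler structure with ASD orientation is equivalent to a real symmetric spinor $\sigma_{AB}$ with $\nabla_{AA'}\sigma_{BC}=2\epsilon_{A(B}\xi_{C)A'}$. Its conformal factor $\Omega_->0$ is given by $\Omega_-^{-2}=\frac12\sigma_{AB}\sigma^{AB}$ (assumed non-zero), and its complex structure by $(J_-)^a{}_b=\Omega_-\sigma^A_B\delta^{A'}_{B'}$. The vector field $\xi^a$ is Killing because $R_{ab}=0$. A Killing vector is called ASD if the SD part of $\nabla_a\xi_b$ vanishes. The integrability conditions force $\Psi_{ABCD}$ to be of type D with principal spinors $o_A,o^\dagger_A$, $o_Ao^{\dagger A}=1$, and the paper's normalisation is $$\Psi_{ABCD}=6\Omega_-^3o_{(A}o_Bo^\dagger_Co^\dagger_{D)},\qquad\sigma_{AB}=2\mathrm{i}\,\Omega_-^{-1}o_{(A}o^\dagger_{B)}.$$ In these conventions the ASD part of $\nabla_a\xi_b$ is $\varphi_{AB}\epsilon_{A'B'}$ with $\varphi_{AB}=\frac12\nabla_{AA'}\xi^{A'}_B=-\frac12\Omega_-^3\sigma_{AB}$, so that $\nabla_a\xi_b=-\frac12\Omega_-^3\sigma_{AB}\epsilon_{A'B'}+\chi_{A'B'}\epsilon_{AB}$.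 *)

(* Defs.v *)
From HB Require Import structures.
From mathcomp Require Import all_boot all_order all_algebra.
From mathcomp Require Import all_classical all_reals all_analysis.
From mathcomp Require Export complex.
Set Implicit Arguments.
Unset Strict Implicit.
Unset Printing Implicit Defensive.
Import Order.TTheory GRing.Theory Num.Theory.
Import numFieldNormedType.Exports.
Local Open Scope classical_set_scope.
Local Open Scope ring_scope.
Local Open Scope complex_scope.

(** * Smooth 4-manifolds

    Fields are functions on M, or families of component functions
    [cindex X -> M -> ...], and only their values on [dom i] matter
    for the index i. *)

(* C^oo on U: all iterated partial derivatives exist and are (Frechet)
   differentiable at every point of U. *)
Definition smooth_on (R : realType) (U : set 'rV[R]_4) (f : 'rV[R]_4 -> R) :=
  forall (s : seq 'I_4) (y : 'rV[R]_4), U y ->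
    differentiable
      (foldr (fun (m : 'I_4) (h : 'rV[R]_4 -> R) (z : 'rV[R]_4) =>
                'D_(delta_mx 0 m) h z) f s) y.

Record atlas (R : realType) (M : topologicalType) := Atlas {
  cindex : Type;
  dom : cindex -> set M;
  chart : cindex -> M -> 'rV[R]_4;
  chartV : cindex -> 'rV[R]_4 -> M;
  dom_open : forall i, open (dom i);
  dom_cover : forall p : M, exists i, dom i p;
  chart_open : forall i, open (chart i @` dom i);
  chartK : forall i p, dom i p -> chartV i (chart i p) = p;
  chart_continuous : forall i p, dom i p -> {for p, continuous (chart i)};
  chartV_continuous : forall i y, (chart i @` dom i) y ->
    {for y, continuous (chartV i)};
  chart_smooth : forall i j (n : 'I_4),
    smooth_on (chart i @` (dom i `&` dom j))
              (fun y => chart j (chartV i y) 0 n)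
}.

Arguments dom {R M} _ _ _.
Arguments chart {R M} _ _ _.
Arguments chartV {R M} _ _ _.

Section Differentiation.
Context (R : realType) (M : topologicalType) (X : atlas R M).
Implicit Types (i : cindex X) (m : 'I_4) (p : M).

Definition partial i m (f : M -> R) p : R :=
  'D_(delta_mx 0 m) (fun y => f (chartV X i y)) (chart X i p).

Definition cpartial i m (f : M -> R[i]) p : R[i] :=
  partial i m (fun q => complex.Re (f q)) p
  +i* partial i m (fun q => complex.Im (f q)) p.

Definition smooth i (f : M -> R) :=
  smooth_on (chart X i @` dom X i) (fun y => f (chartV X i y)).

Definition csmooth i (f : M -> R[i]) :=
  smooth i (fun q => complex.Re (f q)) /\ smooth i (fun q => complex.Im (f q)).

(* [jac i j p] m n is the derivative of the n-th coordinate of chart j along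
   the m-th coordinate vector field of chart i. *)
Definition jac i (j : cindex X) p : 'M[R]_4 :=
  \matrix_(m, n) partial i m (fun q => chart X j q 0 n) p.

Definition lie_bracket i (V W : M -> 'I_4 -> R[i]) p (m : 'I_4) : R[i] :=
  \sum_(n < 4) (V p n * cpartial i n (fun q => W q m) p
                - W p n * cpartial i n (fun q => V q m) p).

End Differentiation.

Arguments partial {R M} X i m f p.
Arguments cpartial {R M} X i m f p.
Arguments smooth {R M} X i f.
Arguments csmooth {R M} X i f.
Arguments jac {R M} X i j p.
Arguments lie_bracket {R M} X i V W p m.

Record metric (R : realType) (M : topologicalType) (X : atlas R M) := Metric {
  gmx : cindex X -> M -> 'M[R]_4;
  gmx_smooth : forall i m n, smooth X i (fun p => gmx i p m n);
  gmx_sym : forall i p, dom X i p -> (gmx i p)^T = gmx i p;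
  gmx_pos : forall i p (v : 'rV[R]_4), dom X i p -> v != 0 ->
    0 < (v *m gmx i p *m v^T) 0 0;
  gmx_change : forall i j p, dom X i p -> dom X j p ->
    gmx i p = jac X i j p *m gmx j p *m (jac X i j p)^T
}.

(** * Spinor algebra

    The indices A, A' range over 'I_2 and an abstract index a is the pair
    (A, A').  Following Penrose and Rindler, eps_01 = eps^01 = 1,
    k^A = eps^AB k_B and k_B = k^A eps_AB; the arrays eps_AB, eps^AB,
    eps_A'B' and eps^A'B' coincide.  All components below are those with
    lowered indices, unless stated otherwise. *)

Notation vidx := ('I_2 * 'I_2)%type.

Section SpinorAlgebra.
Context (R : realType).
Local Notation C := R[i].

Definition eps (A B : 'I_2) : C := (A < B)%N%:R - (B < A)%N%:R.

Definition geps (a b : vidx) : C := eps a.1 b.1 * eps a.2 b.2.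

Definition sym2 (T : 'I_2 -> 'I_2 -> C) A B : C := (T A B + T B A) / 2%:R.

Definition sym3 (T : 'I_2 -> 'I_2 -> 'I_2 -> C) A B D : C :=
  (sym2 (T A) B D + sym2 (T B) A D + sym2 (T D) A B) / 3%:R.

Definition sym4 (T : 'I_2 -> 'I_2 -> 'I_2 -> 'I_2 -> C) A B D E : C :=
  (sym3 (T A) B D E + sym3 (T B) A D E
   + sym3 (T D) A B E + sym3 (T E) A B D) / 4%:R.

Definition vsym2 (T : vidx -> vidx -> C) a b : C := (T a b + T b a) / 2%:R.

Definition vsym3 (T : vidx -> vidx -> vidx -> C) a b c : C :=
  (vsym2 (T a) b c + vsym2 (T b) a c + vsym2 (T c) a b) / 3%:R.

(* Euclidean conjugation: on raised components (k^0, k^1) it is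
   (- conj k^1, conj k^0), that is (- conj k_1, conj k_0) on lowered ones. *)
Definition dag1 (k : 'I_2 -> C) (A : 'I_2) : C :=
  - \sum_(B < 2) eps A B * conjc (k B).

(* The same operation on each of two indices, both primed or both unprimed. *)
Definition dag2 (s : 'I_2 -> 'I_2 -> C) (A B : 'I_2) : C :=
  \sum_(D < 2) \sum_(E < 2) eps A D * eps B E * conjc (s D E).

Definition dagv (v : vidx -> C) (a : vidx) : C :=
  \sum_(b : vidx) geps a b * conjc (v b).

(* For a mixed tensor J_a^b; the index b transforms with the inverse of geps,
   which is geps itself. *)
Definition dag_end (J : vidx -> vidx -> C) (a b : vidx) : C :=
  \sum_(c : vidx) \sum_(d : vidx) geps a c * conjc (J c d) * geps d b.

(* k_A l^A *)
Definition spair (k l : 'I_2 -> C) : C :=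
  \sum_(A < 2) \sum_(B < 2) eps A B * k A * l B.

(* s_AB s^AB *)
Definition snorm2 (s : 'I_2 -> 'I_2 -> C) : C :=
  \sum_(A < 2) \sum_(B < 2) \sum_(D < 2) \sum_(E < 2)
    eps A D * eps B E * s A B * s D E.

(* v^a, and v_a w^a *)
Definition vraise (v : vidx -> C) (a : vidx) : C :=
  \sum_(b : vidx) geps a b * v b.

Definition vdot (v w : vidx -> C) : C := \sum_(a : vidx) v a * vraise w a.

Definition SU2 (a : 'M[C]_2) : Prop :=
  a *m (map_mx (fun z : C => conjc z) a)^T = 1%:M /\ \det a = 1.

End SpinorAlgebra.

Arguments eps {R} A B.
Arguments geps {R} a b.

(** * Local spin frames and the Levi-Civita spin connection *)

Section SpinGeometry.
Context (R : realType) (M : topologicalType) (X : atlas R M).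
Local Notation C := R[i].

(* [spin_change_at e i j p L L']: at p the frame e_AA' of patch i, rewritten in
   the coordinates of patch j, is L_A^B L'_A'^B' times that of patch j. *)
Definition spin_change_at (e : cindex X -> M -> vidx -> 'I_4 -> C)
    (i j : cindex X) (p : M) (L L' : 'M[C]_2) : Prop :=
  [/\ SU2 L, SU2 L' &
    forall (c : vidx) (n : 'I_4),
      \sum_(m < 4) e i p c m * (jac X i j p m n)%:C
      = \sum_(d : vidx) L c.1 d.1 * L' c.2 d.2 * e j p d n].

(* A null tetrad e_AA' on each patch, with g(e_a, e_b) = eps_AB eps_A'B'.
   A vector V^AA' e_AA' is real iff V is invariant under the Euclidean
   conjugation, which is the condition [frame_real].  Frames of overlapping
   patches differ by SU(2) x SU(2), not just O(4): this orients M, the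
   2-forms phi_A'B' eps_AB being called self-dual. *)
Record spin_frames (g : metric X) := SpinFrames {
  frame : cindex X -> M -> vidx -> 'I_4 -> C;
  frame_smooth : forall i a m, csmooth X i (fun p => frame i p a m);
  frame_real : forall i p, dom X i p -> forall m a,
    dagv (fun b => frame i p b m) a = frame i p a m;
  frame_metric : forall i p, dom X i p -> forall a b,
    \sum_(m < 4) \sum_(n < 4)
      (gmx g i p m n)%:C * frame i p a m * frame i p b n = geps a b;
  frame_change : forall i j p, dom X i p -> dom X j p ->
    exists L L', spin_change_at frame i j p L L'
}.

Context (g : metric X) (e : spin_frames g).
Implicit Types (i : cindex X) (p : M) (a b c d : vidx) (A B : 'I_2).

Definition spin_change := spin_change_at (frame e).

(* e_a f *)
Definition fderiv i a (f : M -> C) p : C :=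
  \sum_(m < 4) frame e i p a m * cpartial X i m f p.

(* gamma_ab^c = Gamma_aB^C delta_B'^C' + Gamma'_aB'^C' delta_B^C *)
Definition vconn (G G' : vidx -> 'I_2 -> 'I_2 -> C) (a b c : vidx) : C :=
  G a b.1 c.1 * (b.2 == c.2)%:R + G' a b.2 c.2 * (b.1 == c.1)%:R.

(* The torsion-free connection with nabla eps = 0 on both spinor bundles:
   nabla_a k_B = e_a k_B - Gamma_aB^C k_C, and likewise with Gamma' for primed
   spinors.  By [sconn_eps], [sconn'_eps] the coefficients Gamma_aBC and
   Gamma'_aB'C' are symmetric in BC; [sconn_torsion] says
   [e_a, e_b] = (gamma_ab^c - gamma_ba^c) e_c. *)
Record spin_connection := SpinConnection {
  sconn : cindex X -> M -> vidx -> 'I_2 -> 'I_2 -> C;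
  sconn' : cindex X -> M -> vidx -> 'I_2 -> 'I_2 -> C;
  sconn_smooth : forall i a A B, csmooth X i (fun p => sconn i p a A B);
  sconn'_smooth : forall i a A B, csmooth X i (fun p => sconn' i p a A B);
  sconn_eps : forall i p, dom X i p -> forall a A B,
    \sum_(D < 2) (sconn i p a A D * eps D B + sconn i p a B D * eps A D) = 0;
  sconn'_eps : forall i p, dom X i p -> forall a A B,
    \sum_(D < 2) (sconn' i p a A D * eps D B + sconn' i p a B D * eps A D) = 0;
  sconn_torsion : forall i p, dom X i p -> forall a b m,
    lie_bracket X i (fun q => frame e i q a) (fun q => frame e i q b) p m
    = \sum_(c : vidx) (vconn (sconn i p) (sconn' i p) a b c
                       - vconn (sconn i p) (sconn' i p) b a c) * frame e i p c m
}.

Context (nab : spin_connection).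

Definition gam i p : vidx -> vidx -> vidx -> C :=
  vconn (sconn nab i p) (sconn' nab i p).

(** ** Covariant derivatives *)

(* nabla_a s_BC for an unprimed spinor s_BC *)
Definition nabla_s i (s : M -> 'I_2 -> 'I_2 -> C) p a (A B : 'I_2) : C :=
  fderiv i a (fun q => s q A B) p
  - \sum_(D < 2) (sconn nab i p a A D * s p D B + sconn nab i p a B D * s p A D).

Definition nabla_v i (v : M -> vidx -> C) p a b : C :=
  fderiv i a (fun q => v q b) p - \sum_(c : vidx) gam i p a b c * v p c.

Definition nabla_t i (T : M -> vidx -> vidx -> C) p a b c : C :=
  fderiv i a (fun q => T q b c) p
  - \sum_(d : vidx) (gam i p a b d * T p d c + gam i p a c d * T p b d).

(* nabla_a J_b^c *)
Definition nabla_end i (J : M -> vidx -> vidx -> C) p a b c : C :=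
  fderiv i a (fun q => J q b c) p
  + \sum_(d : vidx) (gam i p a d c * J p b d - gam i p a b d * J p d c).

(** ** Curvature *)

(* R_abC^D, with (nabla_a nabla_b - nabla_b nabla_a) k^D = R_abC^D k^C; the
   last sum comes from [e_a, e_b]. *)
Definition spin_curv_of (i : cindex X) (G : M -> vidx -> 'I_2 -> 'I_2 -> C)
    p a b (A D : 'I_2) : C :=
  fderiv i a (fun q => G q b A D) p - fderiv i b (fun q => G q a A D) p
  + \sum_(E < 2) (G p b A E * G p a E D - G p a A E * G p b E D)
  - \sum_(c : vidx) (gam i p a b c - gam i p b a c) * G p c A D.

(* R_abCD and R_abC'D' *)
Definition spin_curv i p a b (A B : 'I_2) : C :=
  \sum_(D < 2) spin_curv_of i (sconn nab i) p a b A D * eps D B.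

Definition spin_curv' i p a b (A B : 'I_2) : C :=
  \sum_(D < 2) spin_curv_of i (sconn' nab i) p a b A D * eps D B.

Definition riemann i p a b c d : C :=
  spin_curv i p a b c.1 d.1 * eps c.2 d.2
  + spin_curv' i p a b c.2 d.2 * eps c.1 d.1.

(* R_ab = R_acb^c *)
Definition ricci i p a b : C :=
  \sum_(c : vidx) \sum_(d : vidx) geps c d * riemann i p a c b d.

(* Psi_ABCD and its primed analogue are the totally symmetric parts of
   X_ABCD = 1/2 eps^A'B' R_abCD and 1/2 eps^AB R_abC'D'. *)
Definition Weyl_asd i p : 'I_2 -> 'I_2 -> 'I_2 -> 'I_2 -> C :=
  sym4 (fun A B D E =>
    (\sum_(A' < 2) \sum_(B' < 2)
       eps A' B' * spin_curv i p (A, A') (B, B') D E) / 2%:R).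

Definition Weyl_sd i p : 'I_2 -> 'I_2 -> 'I_2 -> 'I_2 -> C :=
  sym4 (fun A' B' D' E' =>
    (\sum_(A < 2) \sum_(B < 2)
       eps A B * spin_curv' i p (A, A') (B, B') D' E') / 2%:R).

(** ** Globally defined fields *)

Definition real_spinor_field (s : cindex X -> M -> 'I_2 -> 'I_2 -> C) : Prop :=
  [/\ forall i A B, csmooth X i (fun p => s i p A B),
      forall i p, dom X i p -> forall A B, dag2 (s i p) A B = s i p A B &
      forall i j p L L', dom X i p -> dom X j p -> spin_change i j p L L' ->
        forall A B, s i p A B
          = \sum_(D < 2) \sum_(E < 2) L A D * L B E * s j p D E].

Definition real_vector_field (v : cindex X -> M -> vidx -> C) : Prop :=
  [/\ forall i c, csmooth X i (fun p => v i p c),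
      forall i p, dom X i p -> forall c, dagv (v i p) c = v i p c &
      forall i j p L L', dom X i p -> dom X j p -> spin_change i j p L L' ->
        forall c, v i p c = \sum_(d : vidx) L c.1 d.1 * L' c.2 d.2 * v j p d].

(* J_a^b, acting on vectors by V^a |-> J_a^b V^a *)
Definition real_end_field (J : cindex X -> M -> vidx -> vidx -> C) : Prop :=
  [/\ forall i c d, csmooth X i (fun p => J i p c d),
      forall i p, dom X i p -> forall c d, dag_end (J i p) c d = J i p c d &
      forall i j p L L', dom X i p -> dom X j p -> spin_change i j p L L' ->
        forall c d,
          \sum_(f : vidx) J i p c f * (L f.1 d.1 * L' f.2 d.2)
          = \sum_(f : vidx) L c.1 f.1 * L' c.2 f.2 * J j p f d].

(* Coordinate components of the vector field v^a e_a *)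
Definition vec_coord i (v : M -> vidx -> C) p (m : 'I_4) : C :=
  \sum_(a : vidx) vraise (v p) a * frame e i p a m.

(** ** Hyper-Kaehler structures *)

(* J followed by K, i.e. the endomorphism K o J *)
Definition end_comp (K J : vidx -> vidx -> C) (a c : vidx) : C :=
  \sum_(b : vidx) J a b * K b c.

(* The 2-form J_ab is of the form phi_A'B' eps_AB iff
   J_a^b = delta_A^B phi_A'^B'. *)
Definition self_dual_end (J : vidx -> vidx -> C) : Prop :=
  exists phi : 'I_2 -> 'I_2 -> C,
    forall a b, J a b = (a.1 == b.1)%:R * phi a.2 b.2.

Definition sd_complex_structure (J : cindex X -> M -> vidx -> vidx -> C) : Prop :=
  real_end_field J /\
  forall i p, dom X i p ->
    [/\ forall a c, end_comp (J i p) (J i p) a c = - (a == c)%:R,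
        forall a b, \sum_(c : vidx) \sum_(d : vidx)
          J i p a c * J i p b d * geps c d = geps a b,
        self_dual_end (J i p) &
        forall a b c, nabla_end i (J i) p a b c = 0].

Definition hyperkahler : Prop :=
  exists I J K : cindex X -> M -> vidx -> vidx -> C,
    [/\ sd_complex_structure I, sd_complex_structure J,
        sd_complex_structure K &
        forall i p, dom X i p -> forall a c,
          end_comp (I i p) (J i p) a c = K i p a c /\
          end_comp (J i p) (I i p) a c = - K i p a c].

(** ** Killing spinors *)

(* nabla_AA' s_BC = 2 eps_A(B xi_C)A' *)
Definition killing_spinor (s : cindex X -> M -> 'I_2 -> 'I_2 -> C)
    (xi : cindex X -> M -> vidx -> C) : Prop :=
  forall i p, dom X i p ->
    (forall A B, s i p A B = s i p B A) /\
    (forall (a : vidx) (B D : 'I_2),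
      nabla_s i (s i) p a B D
      = 2%:R * sym2 (fun E F => eps a.1 E * xi i p (F, a.2)) B D).

(* Om > 0 and Om^-2 = 1/2 s_AB s^AB *)
Definition conformal_factor (s : cindex X -> M -> 'I_2 -> 'I_2 -> C)
    (Om : M -> R) : Prop :=
  forall i p, dom X i p ->
    0 < Om p /\ (((Om p) ^- 2)%:C = snorm2 (s i p) / 2%:R).

(* The scale of the Killing spinor is fixed by
   Psi_ABCD = 6 Om^3 o_(A o_B o+_C o+_D) and s_AB = 2i Om^-1 o_(A o+_B) in
   terms of the principal spinors, with o_A o+^A = 1; at each point o is unique
   only up to a phase, so it is chosen pointwise rather than as a field. *)
Definition type_D_normalised (s : cindex X -> M -> 'I_2 -> 'I_2 -> C)
    (Om : M -> R) : Prop :=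
  forall i p, dom X i p -> exists o : 'I_2 -> C,
    [/\ spair o (dag1 o) = 1,
        forall A B D E, Weyl_asd i p A B D E
          = 6%:R * ((Om p) ^+ 3)%:C
            * sym4 (fun F G H K => o F * o G * dag1 o H * dag1 o K) A B D E &
        forall A B, s i p A B
          = 2%:R * 'i%C * ((Om p)^-1)%:C
            * sym2 (fun F G => o F * dag1 o G) A B].

(* chi_A'B' = 1/2 nabla_AA' xi^A_B' *)
Definition chi_of (xi : cindex X -> M -> vidx -> C) i p (A' B' : 'I_2) : C :=
  (\sum_(A < 2) \sum_(B < 2)
     eps A B * nabla_v i (xi i) p (A, A') (B, B')) / 2%:R.

Definition Eplus (Om : M -> R) (xi : cindex X -> M -> vidx -> C) i p : C :=
  (Om p)%:C + vdot (xi i p) (xi i p).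

(* H_ab = s_AB chi_A'B' - 1/2 E_+ g_ab *)
Definition Htensor (s : cindex X -> M -> 'I_2 -> 'I_2 -> C) (Om : M -> R)
    (xi : cindex X -> M -> vidx -> C) i p (a b : vidx) : C :=
  s i p a.1 b.1 * chi_of xi i p a.2 b.2 - Eplus Om xi i p / 2%:R * geps a b.

(* t_a = H_ab xi^b *)
Definition tvector (s : cindex X -> M -> 'I_2 -> 'I_2 -> C) (Om : M -> R)
    (xi : cindex X -> M -> vidx -> C) i p (a : vidx) : C :=
  \sum_(b : vidx) Htensor s Om xi i p a b * vraise (xi i p) b.

End SpinGeometry.

(* Main.v *)
Require Import Defs.
From mathcomp Require Import all_boot all_order all_algebra.
From mathcomp Require Import all_classical all_reals all_analysis.
From mathcomp Require Import ring.
Import Order.TTheory GRing.Theory Num.Theory.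
Import numFieldNormedType.Exports.
Local Open Scope classical_set_scope.
Local Open Scope ring_scope.
Local Open Scope complex_scope.

(** Hyper-Kaehler kills the primed spin curvature: it commutes with two
    anticommuting complex structures, hence is a multiple of the identity, and
    it is trace-free. Ricci-flatness then leaves only Psi_ABCD, which type D
    expresses as a multiple of Omega^5 sigma_(AB sigma_CD). The Ricci identity
    for sigma gives nabla_a xi_b = -1/2 Omega^3 sigma_AB eps_A'B' + chi_A'B' eps_AB,
    and the Ricci identity for xi then gives nabla chi = 0. Together with
    nabla sigma ~ xi and the derivative of Omega^-2 = det sigma this makes
    (nabla sigma, nabla xi, nabla chi, nabla Omega) a closed system, so every
    claim becomes a polynomial identity in the components of sigma, xi, chi at
    a point. *)

Set Implicit Arguments.
Unset Strict Implicit.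
Unset Printing Implicit Defensive.

(** * Symmetry of second derivatives *)

(** The principal spinors are given only pointwise and up to a phase, so they cannot be
    differentiated; Psi is rewritten through the smooth field sigma before any derivative is taken.
    Omega carries no smoothness assumption either: its differentiability and its gradient both come
    from Omega^-2 = det sigma. Derivatives are commuted only on sigma and xi, which are smooth; for
    chi and Omega one derivative at a point is enough. The form of E_+ is dictated by gradients:
    xi^b nabla_a xi_b has a part in Omega^3 sigma, and adding Omega to xi_b xi^b removes exactly
    this part, leaving the chi part that the symmetrised gradient of sigma chi requires. The vector
    t is then governed by two facts: xi^c nabla_c H_ab = 0, and the endomorphisms H and nabla xi
    commute, since both are built from sigma and chi, which act on different kinds of indices. This
    is why t is Killing and commutes with xi. *)

Lemma is_derive_line (R : realType) (V : normedModType R) (f : V -> R)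
    (y u : V) (s : R) :
  derivable f (y + s *: u) u ->
  is_derive s 1 (fun r => f (y + r *: u)) ('D_u f (y + s *: u)).
Proof.
move=> df.
have E : (fun h : R => h^-1 *: ((fun r => f (y + r *: u)) (h *: 1 + s)
            - f (y + s *: u))) =
         (fun h : R => h^-1 *: (f (h *: u + (y + s *: u)) - f (y + s *: u))).
  apply/funext => h /=; congr (_ *: (f _ - _)).
  by rewrite [h *: 1]mulr1 scalerDl addrCA.
by split; rewrite /derivable /derive /= E.
Qed.

Lemma MVT_line (R : realType) (V : normedModType R) (f : V -> R) (y u : V)
    (s : R) : 0 < s ->
  (forall r, 0 <= r <= s -> derivable f (y + r *: u) u) ->
  exists2 r, 0 < r < s & f (y + s *: u) - f y = s * 'D_u f (y + r *: u).
Proof.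
move=> s0 df.
have D r : 0 <= r <= s ->
    is_derive r 1 (fun r => f (y + r *: u)) ('D_u f (y + r *: u)).
  by move=> /df; exact: is_derive_line.
have [||r rs /=] := @MVT R (fun r => f (y + r *: u))
   (fun r => 'D_u f (y + r *: u)) 0 s s0.
- move=> r; rewrite in_itv /= => /andP[r0 rs]; apply: D.
  by rewrite !ltW.
- apply: derivable_within_continuous => r; rewrite in_itv /= => rs.
  by have [] := D r rs.
- rewrite scale0r addr0 subr0 => ->; exists r; last by rewrite mulrC.
  by move: rs; rewrite in_itv.
Qed.

Lemma is_derive_translate (R : realType) (V W : normedModType R) (f : V -> W)
    (z w u : V) :
  derivable f (z + w) u -> is_derive z u (fun y => f (y + w)) ('D_u f (z + w)).
Proof.
move=> df.
have E : (fun h : R => h^-1 *: (f (h *: u + z + w) - f (z + w))) =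
     (fun h : R => h^-1 *: (f (h *: u + (z + w)) - f (z + w))).
  by apply/funext => h /=; rewrite addrA.
by split; rewrite /derivable /derive /= E.
Qed.

(** The mean value theorem is applied first along u, to the increment of [f] over [s *: v], and then
    along v, to ['D_u f]. *)
Lemma second_difference (R : realType) (V : normedModType R) (f : V -> R)
    (y u v : V) (s : R) : 0 < s ->
  (forall r t, 0 <= r <= s -> 0 <= t <= s ->
     derivable f (y + r *: u + t *: v) u /\
     derivable ('D_u f) (y + r *: u + t *: v) v) ->
  exists r t, [/\ 0 <= r <= s, 0 <= t <= s &
    f (y + s *: u + s *: v) - f (y + s *: u) - f (y + s *: v) + f y
    = s * (s * 'D_v ('D_u f) (y + r *: u + t *: v))].
Proof.
move=> s0 df.
have ss : 0 <= s <= s by rewrite lexx ltW.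
have s00 : 0 <= (0 : R) <= s by rewrite lexx ltW.
have dd r : 0 <= r <= s -> is_derive (y + r *: u) u (fun z => f (z + s *: v) - f z)
    ('D_u f (y + r *: u + s *: v) - 'D_u f (y + r *: u)).
  move=> rs; have [d1 _] := df r s rs ss.
  have [] := df r 0 rs s00; rewrite scale0r addr0 => d2 _.
  have := is_derive_translate d1 => d1'; have := derivableP d2 => d2'.
  exact: is_deriveB.
have W r : 0 < r < s -> 0 <= r <= s by move=> /andP[a b]; rewrite !ltW.
have [r rs E1] := MVT_line s0 (fun r rs => ex_derive (is_derive := dd r rs)).
have [t ts E2] := MVT_line s0 (fun t ts => proj2 (df r t (W _ rs) ts)).
exists r, t; split; [exact: W|exact: W|].
rewrite -E2 -(derive_val (is_derive := dd r (W _ rs))) -E1.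
ring.
Qed.

(** The second difference, computed in both orders, makes the two mixed derivatives agree at two
    points of an arbitrarily small ball; continuity at y closes the gap. *)
Lemma schwarz (R : realType) (V : normedModType R) (f : V -> R) (y u v : V) :
  (\forall z \near y, [/\ derivable f z u, derivable f z v,
     derivable ('D_u f) z v & derivable ('D_v f) z u]) ->
  {for y, continuous ('D_v ('D_u f))} -> {for y, continuous ('D_u ('D_v f))} ->
  'D_v ('D_u f) y = 'D_u ('D_v f) y.
Proof.
move=> dn cvu cuv; apply/eqP; rewrite -subr_eq0 -normr_le0; apply/ler_addgt0Pl.
move=> e e0; rewrite addr0.
have e2 : 0 < e / 2 by rewrite divr_gt0.
have Fy : Filter (nbhs y) := nbhs_filter y.
have n1 := (@cvgrPdist_lt _ _ _ (nbhs y) Fy _ _).1 cvu _ e2.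
have n2 := (@cvgrPdist_lt _ _ _ (nbhs y) Fy _ _).1 cuv _ e2.
have nb := @filterI _ (nbhs y) Fy _ _ dn (@filterI _ (nbhs y) Fy _ _ n1 n2).
have [d /= d0 Bd] := (@nbhs_ballP _ _ y _).1 nb.
(* The [+ 1] keeps N positive even if u = v = 0. Since s N = d / 2, the parallelogram with sides s u
   and s v stays in the ball of radius d. *)
pose N := `|u| + `|v| + 1.
have N0 : 0 < N by rewrite ltr_wpDl ?addr_ge0.
pose s := d / (N + N).
have NN0 : 0 < N + N by rewrite addr_gt0.
have s0 : 0 < s by rewrite divr_gt0.
have B r t : 0 <= r <= s -> 0 <= t <= s -> ball y d (y + r *: u + t *: v).
  move=> /andP[r0 rs] /andP[t0 ts]; rewrite -ball_normE /ball_ /=.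
  rewrite -addrA opprD addNKr normrN.
  apply: le_lt_trans (ler_normD _ _) _; rewrite !normrZ !ger0_norm //.
  have : r * `|u| + t * `|v| <= s * (`|u| + `|v|).
    by rewrite mulrDr lerD // ler_wpM2r.
  move=> /le_lt_trans; apply.
  apply: (@lt_le_trans _ _ (s * N)).
    by rewrite ltr_pM2l // ltrDl.
  rewrite /s -mulrA ger_pMr // mulrC ler_pdivrMr // mul1r lerDl.
  exact: ltW.
have B' r t : 0 <= r <= s -> 0 <= t <= s -> ball y d (y + r *: v + t *: u).
  by move=> hr ht; rewrite addrAC; exact: B.
have [|r1 [t1 [rs1 ts1 Q1]]] := @second_difference R V f y u v s s0.
  by move=> r t hr ht; have /Bd [[? _ ? _] _] := B _ _ hr ht.
have [|r2 [t2 [rs2 ts2 Q2]]] := @second_difference R V f y v u s s0.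
  by move=> r t hr ht; have /Bd [[_ ? _ ?] _] := B' _ _ hr ht.
have E12 : 'D_v ('D_u f) (y + r1 *: u + t1 *: v)
         = 'D_u ('D_v f) (y + r2 *: v + t2 *: u).
  have sn : s != 0 by rewrite gt_eqF.
  apply: (mulfI sn); apply: (mulfI sn); apply: etrans (esym Q1) (etrans _ Q2).
  by rewrite [y + s *: v + s *: u]addrAC; ring.
have /Bd [_ [/ltW h1 _]] := B _ _ rs1 ts1.
have /Bd [_ [_ /ltW h2]] := B' _ _ rs2 ts2.
rewrite -E12 distrC in h2.
have h := lerD h1 h2; rewrite -splitr in h.
exact: le_trans (ler_distD _ _ _) h.
Qed.

(** * Calculus in a chart *)

Section ChartCalculus.
Context (R : realType) (M : topologicalType) (X : atlas R M).
Local Notation C := R[i].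
Implicit Types (i : cindex X) (p : M) (m n : 'I_4) (f g : M -> C).

(** Real differentiability of both components at one point: what the product rules require, and what
    is established for Omega and chi. *)
Definition cdiff i p f :=
  differentiable (fun y => complex.Re (f (chartV X i y))) (chart X i p) /\
  differentiable (fun y => complex.Im (f (chartV X i y))) (chart X i p).

Lemma chartVK i y : (chart X i @` dom X i) y -> chart X i (chartV X i y) = y.
Proof. by case=> p dp <-; rewrite chartK. Qed.

Lemma dom_chartV i y : (chart X i @` dom X i) y -> dom X i (chartV X i y).
Proof. by case=> p dp <-; rewrite chartK. Qed.

Lemma nbhs_chart i p : dom X i p ->
  nbhs (chart X i p) (chart X i @` dom X i).
Proof. by move=> dp; apply: open_nbhs_nbhs; split; [exact: chart_open|exists p]. Qed.

Lemma eq_partial i m p (f g : M -> R) : dom X i p ->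
  (forall q, dom X i q -> f q = g q) -> partial X i m f p = partial X i m g p.
Proof.
move=> dp fg; apply: near_eq_derive.
by apply: filterS (nbhs_chart dp) => y /dom_chartV; exact: fg.
Qed.

Lemma eq_cpartial i m p f g : dom X i p ->
  (forall q, dom X i q -> f q = g q) -> cpartial X i m f p = cpartial X i m g p.
Proof.
by move=> dp fg; congr Complex; apply: eq_partial => // q /fg ->.
Qed.

(** The difference g - f vanishes near y, so it is o(id) with differential 0, and g = (g - f) +
    f. *)
Lemma eq_differentiable (U V : normedModType R) (f g : U -> V) y (S : set U) :
  nbhs y S -> (forall z, S z -> f z = g z) -> differentiable f y ->
  differentiable g y.
Proof.
move=> nS fg df.
have h0 z : S z -> (g - f) z = 0 by move=> /fg fgz; rewrite !fctE fgz subrr.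
have dh : (g - f) \o shift y = cst ((g - f) y) + (\0 : {linear U -> V}) +o_ 0 id.
  apply/eqaddoP => _/posnumP[e].
  have nS0 : nbhs 0 (shift y @^-1` S) .
    have [d /= d0 dS] := (@nbhs_ballP _ _ y S).1 nS.
    apply/nbhs_ballP; exists d => //= z zd; apply: dS; move: zd.
    by rewrite -!ball_normE /ball_ /= sub0r opprD addrCA subrr addr0.
  apply: filterS nS0 => z /= /h0 Sz; rewrite !fctE /= in Sz *.
  rewrite Sz (_ : g y - f y = 0); last exact: (h0 _ (nbhs_singleton nS)).
  by rewrite addr0 subrr normr0 mulr_ge0.
have hc : continuous (\0 : {linear U -> V}) by move=> z; exact: cst_continuous.
have dgf : differentiable (g - f) y.
  by apply/diff_locallyP; rewrite (diff_unique hc dh).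
by rewrite -[g](subrK f); exact: differentiableD.
Qed.

Lemma cdiff_cst i p (c : C) : cdiff i p (fun=> c).
Proof. by split; exact: differentiable_cst. Qed.

Let rep i f (y : 'rV[R]_4) : R := complex.Re (f (chartV X i y)).
Let imp i f (y : 'rV[R]_4) : R := complex.Im (f (chartV X i y)).

Let repD i f g : rep i (fun q => f q + g q) = rep i f + rep i g.
Proof. by apply/funext => y; rewrite fctE /rep; case: (f _) => ? ?; case: (g _). Qed.

Let impD i f g : imp i (fun q => f q + g q) = imp i f + imp i g.
Proof. by apply/funext => y; rewrite fctE /imp; case: (f _) => ? ?; case: (g _). Qed.

Let repM i f g :
  rep i (fun q => f q * g q) = rep i f * rep i g - imp i f * imp i g.
Proof.
apply/funext => y; rewrite [RHS]/(_ - _) /= /rep /imp.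
by rewrite /GRing.mul /=; case: (f _) => ? ?; case: (g _).
Qed.

Let impM i f g :
  imp i (fun q => f q * g q) = rep i f * imp i g + imp i f * rep i g.
Proof.
apply/funext => y; rewrite [RHS]/(_ + _) /= /rep /imp.
by rewrite /GRing.mul /=; case: (f _) => ? ?; case: (g _).
Qed.

Lemma cdiffD i p f g : cdiff i p f -> cdiff i p g ->
  cdiff i p (fun q => f q + g q).
Proof.
move=> [f1 f2] [g1 g2]; split.
  by rewrite -/(rep i (fun q => f q + g q)) repD; exact: differentiableD.
by rewrite -/(imp i (fun q => f q + g q)) impD; exact: differentiableD.
Qed.

Lemma cdiffM i p f g : cdiff i p f -> cdiff i p g ->
  cdiff i p (fun q => f q * g q).
Proof.
move=> [f1 f2] [g1 g2]; split.
  by rewrite -/(rep i (fun q => f q * g q)) repM; apply: differentiableB; apply: differentiableM.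
by rewrite -/(imp i (fun q => f q * g q)) impM; apply: differentiableD; apply: differentiableM.
Qed.

Lemma cpartialD i m p f g : cdiff i p f -> cdiff i p g ->
  cpartial X i m (fun q => f q + g q) p = cpartial X i m f p + cpartial X i m g p.
Proof.
move=> [f1 f2] [g1 g2]; rewrite /cpartial /partial.
rewrite -/(rep i (fun q => f q + g q)) -/(imp i (fun q => f q + g q)) repD impD.
by rewrite !deriveD; try exact: diff_derivable.
Qed.

Let mulcE (a b c d : R) : (a +i* b) * (c +i* d) = (a * c - b * d) +i* (a * d + b * c).
Proof. by []. Qed.

Let addcE (a b c d : R) : (a +i* b) + (c +i* d) = (a + c) +i* (b + d).
Proof. by []. Qed.

Lemma cpartialM i m p f g : dom X i p -> cdiff i p f -> cdiff i p g ->
  cpartial X i m (fun q => f q * g q) p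
  = f p * cpartial X i m g p + cpartial X i m f p * g p.
Proof.
move=> dp [f1 f2] [g1 g2]; rewrite /cpartial /partial.
rewrite -/(rep i (fun q => f q * g q)) -/(imp i (fun q => f q * g q)) repM impM.
have dd (h : 'rV[R]_4 -> R) : differentiable h (chart X i p) ->
    derivable h (chart X i p) (delta_mx 0 m) by exact: diff_derivable.
rewrite deriveB ?deriveD; try by apply: derivableM; exact: dd.
rewrite !deriveM; try exact: dd.
rewrite /rep /imp chartK //.
move: ('D__ _ _) ('D__ _ _) ('D__ _ _) ('D__ _ _) => a b c d.
case: (f p) (g p) => x y [z w] /=; rewrite !mulcE !addcE /GRing.scale /=.
by congr Complex; ring.
Qed.

Lemma csmooth_cdiff i p f : csmooth X i f -> dom X i p -> cdiff i p f.
Proof.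
by move=> [s1 s2] dp; split; [apply: (s1 [::])|apply: (s2 [::])]; exists p.
Qed.

(** Serves [smooth_partial]: [partial] evaluates at the chart image of [chartV X i y], which is y
    only inside the range of the chart. *)
Lemma smooth_on_eq (U : set 'rV[R]_4) (f g : 'rV[R]_4 -> R) : open U ->
  (forall y, U y -> f y = g y) -> smooth_on U f -> smooth_on U g.
Proof.
move=> oU fg sf s y Uy.
have nU z : U z -> nbhs z U by move=> Uz; apply: open_nbhs_nbhs.
apply: eq_differentiable (sf s y Uy).
  exact: (nU _ Uy).
elim: s => [|m s IHs] //= z Uz; apply: near_eq_derive.
by apply: filterS (nU _ Uz); exact: IHs.
Qed.

Lemma smooth_partial i m (f : M -> R) : smooth X i f ->
  smooth X i (partial X i m f).
Proof.
move=> sf; apply: (@smooth_on_eq _ ('D_(delta_mx 0 m) (fun y => f (chartV X i y)))).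
- exact: chart_open.
- by move=> y Uy; rewrite /partial chartVK.
(* The derivative along m is taken first, so it is the innermost one and goes to the end of the
   list. *)
- by move=> s y Uy; have := sf (rcons s m) y Uy; rewrite foldr_rcons.
Qed.

Lemma csmooth_cpartial i m f : csmooth X i f -> csmooth X i (cpartial X i m f).
Proof. by move=> [s1 s2]; split; exact: smooth_partial. Qed.

Lemma partialC i m n (f : M -> R) p : smooth X i f -> dom X i p ->
  partial X i m (partial X i n f) p = partial X i n (partial X i m f) p.
Proof.
move=> sf dp.
have Up : (chart X i @` dom X i) (chart X i p) by exists p.
have E k l : partial X i k (partial X i l f) p =
    'D_(delta_mx 0 k) ('D_(delta_mx 0 l) (fun y => f (chartV X i y))) (chart X i p).
  apply: near_eq_derive; apply: filterS (nbhs_chart dp) => y Uy.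
  by rewrite /partial chartVK.
rewrite !E; apply: schwarz.
- apply: filterS (nbhs_chart dp) => y Uy; split; apply: diff_derivable.
  + exact: (sf [::]).
  + exact: (sf [::]).
  + exact: (sf [:: n]).
  + exact: (sf [:: m]).
- apply: differentiable_continuous; exact: (sf [:: m; n]).
- apply: differentiable_continuous; exact: (sf [:: n; m]).
Qed.

Lemma cpartialC i m n f p : csmooth X i f -> dom X i p ->
  cpartial X i m (cpartial X i n f) p = cpartial X i n (cpartial X i m f) p.
Proof.
move=> [s1 s2] dp.
exact: (f_equal2 (@Complex R) (partialC m n s1 dp) (partialC m n s2 dp)).
Qed.

Lemma cpartial_cst i m p (c : C) : cpartial X i m (fun=> c) p = 0.
Proof. by rewrite /cpartial /partial !derive_cst. Qed.

Lemma cdiff_sum i p (I : Type) (r : seq I) (P : pred I) (F : I -> M -> C) :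
  (forall k, cdiff i p (F k)) -> cdiff i p (fun q => \sum_(k <- r | P k) F k q).
Proof.
move=> dF; elim: r => [|k r IHr].
  rewrite (_ : (fun _ => _) = fun=> 0); first exact: cdiff_cst.
  by apply/funext => q; rewrite big_nil.
case Pk: (P k).
  rewrite (_ : (fun _ => _) = fun q => F k q + \sum_(k <- r | P k) F k q).
    exact: cdiffD.
  by apply/funext => q; rewrite big_cons Pk.
rewrite (_ : (fun _ => _) = fun q => \sum_(k <- r | P k) F k q) //.
by apply/funext => q; rewrite big_cons Pk.
Qed.

Lemma cpartial_sum i m p (I : Type) (r : seq I) (P : pred I) (F : I -> M -> C) :
  (forall k, cdiff i p (F k)) ->
  cpartial X i m (fun q => \sum_(k <- r | P k) F k q) p
  = \sum_(k <- r | P k) cpartial X i m (F k) p.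
Proof.
move=> dF; elim: r => [|k r IHr].
  rewrite (_ : (fun _ => _) = fun=> 0) ?cpartial_cst ?big_nil //.
  by apply/funext => q; rewrite big_nil.
rewrite big_cons -IHr; case Pk: (P k).
  rewrite (_ : (fun _ => _) = fun q => F k q + \sum_(k <- r | P k) F k q).
    by rewrite cpartialD //; exact: cdiff_sum.
  by apply/funext => q; rewrite big_cons Pk.
rewrite (_ : (fun _ => _) = fun q => \sum_(k <- r | P k) F k q) //.
by apply/funext => q; rewrite big_cons Pk.
Qed.

End ChartCalculus.
Arguments cdiff {R M} X i p f.

(** * Frame derivatives and the Ricci identity *)

Local Notation i0 := (@ord0 1).
Local Notation i1 := (@ord_max 1).

Lemma I2_ind (P : 'I_2 -> Prop) : P i0 -> P i1 -> forall A, P A.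
Proof.
move=> P0 P1 [[|[|//]] h]; first by rewrite (_ : Ordinal h = i0) //; apply: val_inj.
by rewrite (_ : Ordinal h = i1) //; apply: val_inj.
Qed.

Lemma vidx_ind (P : vidx -> Prop) :
  P (i0, i0) -> P (i0, i1) -> P (i1, i0) -> P (i1, i1) -> forall a, P a.
Proof. by move=> ? ? ? ? [A A']; elim/I2_ind: A; elim/I2_ind: A'. Qed.

Lemma big_I2 (V : nmodType) (F : 'I_2 -> V) : \sum_(A < 2) F A = F i0 + F i1.
Proof.
by rewrite big_ord_recl big_ord1; congr (_ + F _); apply: val_inj.
Qed.

Lemma big_vidx (V : nmodType) (F : vidx -> V) :
  \sum_(a : vidx) F a = F (i0, i0) + F (i0, i1) + (F (i1, i0) + F (i1, i1)).
Proof.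
transitivity (\sum_(a : vidx) F (a.1, a.2)); first by apply: eq_bigr => -[].
by rewrite -(pair_bigA _ (fun A A' => F (A, A'))) /= big_I2 !big_I2.
Qed.

Lemma eps00 (R : realType) : @eps R i0 i0 = 0. Proof. by rewrite /eps subrr. Qed.
Lemma eps11 (R : realType) : @eps R i1 i1 = 0. Proof. by rewrite /eps subrr. Qed.
Lemma eps01 (R : realType) : @eps R i0 i1 = 1. Proof. by rewrite /eps subr0. Qed.
Lemma eps10 (R : realType) : @eps R i1 i0 = -1. Proof. by rewrite /eps sub0r. Qed.
Definition epsE := (eps00, eps11, eps01, eps10).

Section FrameCalculus.
Context (R : realType) (M : topologicalType) (X : atlas R M).
Local Notation C := R[i].
Context (g : metric X) (e : spin_frames g) (nab : spin_connection e).
Implicit Types (i : cindex X) (p : M) (a b : vidx) (f h : M -> C).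

Local Notation fderiv := (fderiv e).
Local Notation gam := (gam nab).

Lemma eq_fderiv i a f h p : dom X i p -> (forall q, dom X i q -> f q = h q) ->
  fderiv i a f p = fderiv i a h p.
Proof.
by move=> dp fh; apply: eq_bigr => m _; rewrite (eq_cpartial m dp fh).
Qed.

Lemma fderivD i a f h p : cdiff X i p f -> cdiff X i p h ->
  fderiv i a (fun q => f q + h q) p = fderiv i a f p + fderiv i a h p.
Proof.
move=> df dh; rewrite /Defs.fderiv -big_split /=; apply: eq_bigr => m _.
by rewrite cpartialD // mulrDr.
Qed.

Lemma fderivM i a f h p : dom X i p -> cdiff X i p f -> cdiff X i p h ->
  fderiv i a (fun q => f q * h q) p = f p * fderiv i a h p + fderiv i a f p * h p.
Proof.
move=> dp df dh; rewrite /Defs.fderiv mulr_sumr mulr_suml -big_split /=.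
apply: eq_bigr => m _; rewrite cpartialM // mulrDr; congr (_ + _).
  by rewrite mulrCA.
by rewrite mulrA.
Qed.

Lemma fderiv_cst i a p (c : C) : fderiv i a (fun=> c) p = 0.
Proof. by rewrite /Defs.fderiv big1 // => m _; rewrite cpartial_cst mulr0. Qed.

Lemma fderivZ i a f p (c : C) : dom X i p -> cdiff X i p f ->
  fderiv i a (fun q => c * f q) p = c * fderiv i a f p.
Proof.
move=> dp df; rewrite fderivM // ?fderiv_cst ?mul0r ?addr0 //; exact: cdiff_cst.
Qed.

Lemma cdiffZ i f p (c : C) : cdiff X i p f -> cdiff X i p (fun q => c * f q).
Proof. by move=> df; apply: cdiffM => //; exact: cdiff_cst. Qed.

Lemma cdiffN i f p : cdiff X i p f -> cdiff X i p (fun q => - f q).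
Proof.
move=> /(cdiffZ (-1)); rewrite (_ : (fun _ => _) = (fun q => - f q)) //.
by apply/funext => q; rewrite mulN1r.
Qed.

Lemma fderivN i a f p : dom X i p -> cdiff X i p f ->
  fderiv i a (fun q => - f q) p = - fderiv i a f p.
Proof.
move=> dp df; rewrite -mulN1r -fderivZ //; congr Defs.fderiv.
by apply/funext => q; rewrite mulN1r.
Qed.

Lemma cdiffB i f h p : cdiff X i p f -> cdiff X i p h ->
  cdiff X i p (fun q => f q - h q).
Proof. by move=> df /cdiffN; exact: cdiffD. Qed.

Lemma fderivB i a f h p : dom X i p -> cdiff X i p f -> cdiff X i p h ->
  fderiv i a (fun q => f q - h q) p = fderiv i a f p - fderiv i a h p.
Proof. by move=> dp df dh; rewrite fderivD ?fderivN //; exact: cdiffN. Qed.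

Lemma fderiv_sum i a p (I : Type) (r : seq I) (P : pred I) (F : I -> M -> C) :
  (forall k, cdiff X i p (F k)) ->
  fderiv i a (fun q => \sum_(k <- r | P k) F k q) p
  = \sum_(k <- r | P k) fderiv i a (F k) p.
Proof.
move=> dF; rewrite /Defs.fderiv exchange_big /=; apply: eq_bigr => m _.
by rewrite cpartial_sum // mulr_sumr.
Qed.

Lemma cdiff_frame i p a m : dom X i p -> cdiff X i p (fun q => frame e i q a m).
Proof. by apply: csmooth_cdiff; exact: frame_smooth. Qed.

Lemma cdiff_cpartial i p m f : csmooth X i f -> dom X i p ->
  cdiff X i p (cpartial X i m f).
Proof. by move=> sf; apply: csmooth_cdiff; exact: csmooth_cpartial. Qed.

Lemma cdiff_fderiv i p a f : csmooth X i f -> dom X i p ->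
  cdiff X i p (fderiv i a f).
Proof.
move=> sf dp; apply: cdiff_sum => m.
by apply: cdiffM; [exact: cdiff_frame|exact: cdiff_cpartial].
Qed.

(** Structure functions of the frame: the connection being torsion-free, [e_a, e_b] = tors_ab^c e_c
    by [sconn_torsion]. *)
Definition tors i p a b c : C := gam i p a b c - gam i p b a c.

(** The second-order terms cancel by [cpartialC]; the rest is the derivative along [e_a, e_b]. *)
Lemma fderiv_comm i p a b f : csmooth X i f -> dom X i p ->
  fderiv i a (fderiv i b f) p - fderiv i b (fderiv i a f) p
  = \sum_(c : vidx) tors i p a b c * fderiv i c f p.
Proof.
move=> sf dp.
have E a' b' : fderiv i a' (fderiv i b' f) p =
   \sum_(m < 4) \sum_(n < 4) (frame e i p a' m * frame e i p b' n
                   * cpartial X i m (cpartial X i n f) p)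
   + \sum_(n < 4) (\sum_(m < 4) frame e i p a' m
        * cpartial X i m (fun q => frame e i q b' n) p) * cpartial X i n f p.
  rewrite {1}/Defs.fderiv.
  under [X in _ + X]eq_bigr do rewrite mulr_suml.
  rewrite [X in _ + X]exchange_big -big_split /=; apply: eq_bigr => m _.
  rewrite cpartial_sum; last first.
    by move=> n; apply: cdiffM; [exact: cdiff_frame|exact: cdiff_cpartial].
  rewrite mulr_sumr -big_split /=; apply: eq_bigr => n _.
  rewrite cpartialM //; [|exact: cdiff_frame|exact: cdiff_cpartial].
  by rewrite mulrDr !mulrA.
rewrite !E opprD addrACA [X in _ - X + _]exchange_big /=.
under [X in _ - X + _]eq_bigr => m _ do under eq_bigr => n _ do
  rewrite cpartialC // [frame _ _ _ _ _ * _]mulrC.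
rewrite subrr add0r -sumrB.
under [LHS]eq_bigr => n _ do rewrite -mulrBl -sumrB
  -/(lie_bracket X i (fun q => frame e i q a) (fun q => frame e i q b) p n)
  (sconn_torsion nab) // mulr_suml.
rewrite exchange_big /=; apply: eq_bigr => c _.
by rewrite mulr_sumr; apply: eq_bigr => n _; rewrite mulrA.
Qed.

Section RicciIdentity.
Context (T : finType) (A : M -> vidx -> T -> T -> C) (V : M -> T -> C).

(** The index set [T] and its connection [A] are left open, so that one Ricci identity serves the
    vector xi, the two-index spinor sigma and the self-dual part of a parallel endomorphism. No
    connection term acts on the derivative index b. *)
Definition covd i b c q : C :=
  fderiv i b (fun q => V q c) q - \sum_(d : T) A q b c d * V q d.

Definition curv i p a b c d : C :=
  fderiv i a (fun q => A q b c d) p - fderiv i b (fun q => A q a c d) p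
  + \sum_(f : T) (A p b c f * A p a f d - A p a c f * A p b f d)
  - \sum_(f : vidx) tors i p a b f * A p f c d.

(** Connection terms on the derivative index enter only antisymmetrised, which is the [tors] sum on
    the left. The minus sign on the right is that of a lowered index c. *)
Lemma ricci_identity i p a b c :
  (forall a c d, cdiff X i p (fun q => A q a c d)) ->
  (forall c, csmooth X i (fun q => V q c)) -> dom X i p ->
  (fderiv i a (covd i b c) p - \sum_(d : T) A p a c d * covd i b d p)
  - (fderiv i b (covd i a c) p - \sum_(d : T) A p b c d * covd i a d p)
  - \sum_(d : vidx) tors i p a b d * covd i d c p
  = - \sum_(d : T) curv i p a b c d * V p d.
Proof.
move=> dA sV dp.
have dV c' : cdiff X i p (fun q => V q c') by exact: csmooth_cdiff.
have E a' b' : fderiv i a' (covd i b' c) p =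
    fderiv i a' (fderiv i b' (fun q => V q c)) p
    - \sum_(d : T) (A p b' c d * fderiv i a' (fun q => V q d) p
                  + fderiv i a' (fun q => A q b' c d) p * V p d).
  rewrite fderivB //; [|exact: cdiff_fderiv|]; last first.
    by apply: cdiff_sum => d; apply: cdiffM.
  congr (_ - _); rewrite fderiv_sum; last by move=> d; apply: cdiffM.
  by apply: eq_bigr => d _; rewrite fderivM.
have F a' b' : \sum_(d : T) A p a' c d * covd i b' d p =
   \sum_(d : T) A p a' c d * fderiv i b' (fun q => V q d) p
   - \sum_(d : T) (\sum_(f : T) A p a' c f * A p b' f d) * V p d.
  rewrite /covd; under eq_bigr => d _ do rewrite mulrBr [X in _ - X]mulr_sumr.
  rewrite sumrB; congr (_ - _); rewrite exchange_big /=; apply: eq_bigr => d _.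
  by rewrite mulr_suml; apply: eq_bigr => f _; rewrite mulrA.
have G : \sum_(d : vidx) tors i p a b d * covd i d c p =
   \sum_(d : vidx) tors i p a b d * fderiv i d (fun q => V q c) p
   - \sum_(d : T) (\sum_(f : vidx) tors i p a b f * A p f c d) * V p d.
  rewrite /covd; under eq_bigr => d _ do rewrite mulrBr [X in _ - X]mulr_sumr.
  rewrite sumrB; congr (_ - _); rewrite exchange_big /=; apply: eq_bigr => d _.
  by rewrite mulr_suml; apply: eq_bigr => f _; rewrite mulrA.
rewrite !E !F G -fderiv_comm // /curv.
under [in RHS]eq_bigr => d _ do rewrite sumrB !(mulrBl, mulrDl).
rewrite !(sumrB, big_split) /=; ring.
Qed.

End RicciIdentity.

Lemma cdiff_vconn i p (G G' : M -> vidx -> 'I_2 -> 'I_2 -> C) a c d :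
  (forall a A B, cdiff X i p (fun q => G q a A B)) ->
  (forall a A B, cdiff X i p (fun q => G' q a A B)) ->
  cdiff X i p (fun q => vconn (G q) (G' q) a c d).
Proof. by move=> dG dG'; apply: cdiffD; apply: cdiffM => //; exact: cdiff_cst. Qed.

(** On a tensor product the mixed terms in G and G' cancel in the commutator, so the curvature acts
    by the Leibniz rule. *)
Lemma curv_vconn i p (G G' : M -> vidx -> 'I_2 -> 'I_2 -> C) a b c d :
  (forall a A B, cdiff X i p (fun q => G q a A B)) ->
  (forall a A B, cdiff X i p (fun q => G' q a A B)) -> dom X i p ->
  curv (fun q => vconn (G q) (G' q)) i p a b c d
  = curv G i p a b c.1 d.1 * (c.2 == d.2)%:R
    + curv G' i p a b c.2 d.2 * (c.1 == d.1)%:R.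
Proof.
move=> dG dG' dp.
have E a' b' : fderiv i a' (fun q => vconn (G q) (G' q) b' c d) p
   = fderiv i a' (fun q => G q b' c.1 d.1) p * (c.2 == d.2)%:R
   + fderiv i a' (fun q => G' q b' c.2 d.2) p * (c.1 == d.1)%:R.
  rewrite fderivD; try by apply: cdiffM => //; exact: cdiff_cst.
  rewrite !fderivM //; try exact: cdiff_cst.
  by rewrite !fderiv_cst !mulr0 !add0r.
rewrite /curv !E !big_vidx !big_I2 /vconn.
move: (fderiv _ _ _ _) (fderiv _ _ _ _) (fderiv _ _ _ _) (fderiv _ _ _ _) => x y z w.
move: (tors i p a b) (G p) (G' p) => t H H'.
clear E.
elim/vidx_ind: c => /=; elim/vidx_ind: d => /=; rewrite ?eqxx /=;
  rewrite ?(_ : (i0 == i1) = false) ?(_ : (i1 == i0) = false) //=; ring.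
Qed.

End FrameCalculus.

(** * Curvature of a hyper-Kaehler metric *)

(** Elimination by certificate: known equations are combined with [add_eq] and [scale_eq], and
    [ring] or [field] confirms that the combination has the same difference of sides as the goal. *)
Lemma lincomb (V : zmodType) (a b x y : V) : a = b -> x - y = a - b -> x = y.
Proof. by move=> -> /eqP; rewrite subrr subr_eq0 => /eqP. Qed.

Definition add_eq (V : zmodType) (a b c d : V) (h : a = b) (k : c = d) :
  a + c = b + d := f_equal2 +%R h k.

Definition scale_eq (V : pzRingType) (k a b : V) (h : a = b) : k * a = k * b :=
  f_equal ( *%R k) h.

Lemma eq01 : ((i0 == i1) = false) * ((i1 == i0) = false). Proof. by []. Qed.

(** Polarised Cayley-Hamilton: the square of a trace-free 2x2 matrix is minus its determinant. *)
Lemma trace0_comm (K : fieldType) (A B : 'M[K]_2) :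
  \tr A = 0 -> \tr B = 0 -> A * B + B * A = (\tr (A * B))%:M.
Proof.
rewrite /mxtrace !big_I2 => trA trB; apply/matrixP => i j.
have eA : A i1 i1 = - A i0 i0 by apply/eqP; rewrite -addr_eq0 addrC trA.
have eB : B i1 i1 = - B i0 i0 by apply/eqP; rewrite -addr_eq0 addrC trB.
rewrite !mxE !big_I2.
elim/I2_ind: i; elim/I2_ind: j; rewrite ?eqxx ?eq01 ?mulr0n ?mulr1n !eA ?eB; ring.
Qed.

Lemma eq_opp0 (K : numDomainType) (x : K) : x = - x -> x = 0.
Proof.
move=> h; have : x *+ 2 == 0 by rewrite mulr2n {1}h addNr.
by rewrite mulrn_eq0 => /eqP.
Qed.

(* Trace-free 2x2 matrices A, B satisfy AB + BA = tr(AB), so F is a multiple of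
   phi; but the multiples of phi anticommute with psi. *)
Lemma quaternion_centralizer (K : numFieldType) (F phi psi : 'M[K]_2) :
  phi * phi = -1 -> psi * psi = -1 -> phi * psi = - (psi * phi) ->
  \tr F = 0 -> F * phi = phi * F -> F * psi = psi * F -> F = 0.
Proof.
move=> phi2 psi2 anti trF Fphi Fpsi.
have two0 (Y : 'M[K]_2) : Y = - Y -> Y = 0.
  move=> h; apply/matrixP => i j; move/matrixP/(_ i j): h; rewrite !mxE => h.
  exact: eq_opp0.
(* Anticommuting with the invertible [psi] makes [phi] similar to [- phi]. *)
have trphi : \tr phi = 0.
  have E : \tr phi = - \tr phi.
    rewrite -[in LHS](mulr1 phi) -[1]opprK -psi2 mulrN mulrA anti.
    have E : \tr (psi * phi * psi) = \tr (psi * (psi * phi)) by exact: mxtrace_mulC.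
    by rewrite mulNr opprK E mulrA psi2 mulN1r raddfN.
  exact: eq_opp0.
have H := trace0_comm trF trphi; rewrite -Fphi -mulr2n in H.
pose c := \tr (F * phi) / 2%:R.
have Hc : F * phi = c *: 1.
  rewrite scalemx1 /c; apply/matrixP => i j; move/matrixP/(_ i j): H.
  rewrite !mxE mulr2n => h.
  have -> : \tr (F * phi) / 2%:R *+ (i == j) = (\tr (F * phi) *+ (i == j)) / 2%:R.
    by rewrite mulrnAl.
  by rewrite -h; field.
have EF : F = - (c *: phi).
  by rewrite -[in LHS](mulr1 F) -[1]opprK -phi2 mulrN mulrA Hc -scalerAl mul1r.
have F0 : F * psi = 0.
  apply: two0; rewrite {2}Fpsi EF mulNr mulrN -scalerAl -scalerAr anti.
  by rewrite scalerN opprK.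
by rewrite -[F]mulr1 -[1]opprK -psi2 mulrN mulrA F0 mul0r oppr0.
Qed.

(** The three adjacent transpositions generate all permutations; each index order in [sym4] is
    sorted by them. *)
Lemma sym4_id (R : realType) (T : 'I_2 -> 'I_2 -> 'I_2 -> 'I_2 -> R[i]) :
  (forall A B D E, T A B D E = T B A D E) ->
  (forall A B D E, T A B D E = T A D B E) ->
  (forall A B D E, T A B D E = T A B E D) ->
  forall A B D E, sym4 T A B D E = T A B D E.
Proof.
move=> h1 h2 h3 A B D E; rewrite /sym4 /sym3 /sym2.
have -> : T A B E D = T A B D E by rewrite h3.
have -> : T A D B E = T A B D E by rewrite h2.
have -> : T A D E B = T A B D E by rewrite h3 h2.
have -> : T A E B D = T A B D E by rewrite h2 h3.
have -> : T A E D B = T A B D E by rewrite h3 h2 h3.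
have -> : T B A D E = T A B D E by rewrite h1.
have -> : T B A E D = T A B D E by rewrite h3 h1.
have -> : T B D A E = T A B D E by rewrite h2 h1.
have -> : T B D E A = T A B D E by rewrite h3 h2 h1.
have -> : T B E A D = T A B D E by rewrite h2 h1 h3.
have -> : T B E D A = T A B D E by rewrite h3 h2 h1 h3.
have -> : T D A B E = T A B D E by rewrite h1 h2.
have -> : T D A E B = T A B D E by rewrite h3 h1 h2.
have -> : T D B A E = T A B D E by rewrite h2 h1 h2.
have -> : T D B E A = T A B D E by rewrite h3 h2 h1 h2.
have -> : T D E A B = T A B D E by rewrite h2 h1 h3 h2.
have -> : T D E B A = T A B D E by rewrite h3 h2 h1 h3 h2.
have -> : T E A B D = T A B D E by rewrite h1 h2 h3.
have -> : T E A D B = T A B D E by rewrite h3 h1 h2 h3.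
have -> : T E B A D = T A B D E by rewrite h2 h1 h2 h3.
have -> : T E B D A = T A B D E by rewrite h3 h2 h1 h2 h3.
have -> : T E D A B = T A B D E by rewrite h2 h1 h3 h2 h3.
have -> : T E D B A = T A B D E by rewrite h3 h2 h1 h3 h2 h3.
by field.
Qed.

(** In general S_abDE = eps_A'B' X_ABDE + eps_AB Phi_A'B'DE. The Ricci trace consists of Phi,
    symmetric in A'B', and of the contraction X_ABD^B times eps_A'B'; both vanish separately, and
    then X is totally symmetric. *)
Lemma ricci_flat_weyl (R : realType)
    (S : vidx -> vidx -> 'I_2 -> 'I_2 -> R[i]) :
  (forall a b A B, S a b A B = - S b a A B) ->
  (forall a b A B, S a b A B = S a b B A) ->
  (forall a b, \sum_(c : vidx) \sum_(d : vidx)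
     geps c d * (S a c b.1 d.1 * eps b.2 d.2) = 0) ->
  forall a b D E, S a b D E = eps a.2 b.2 *
    sym4 (fun A B D E => (\sum_(A' < 2) \sum_(B' < 2)
       eps A' B' * S (A, A') (B, B') D E) / 2%:R) a.1 b.1 D E.
Proof.
move=> SN SC ric.
have S0 a A B : S a a A B = 0.
  exact: eq_opp0 (SN a a A B).
have N1 := SN (i0, i1) (i0, i0); have N2 := SN (i1, i0) (i0, i0).
have N3 := SN (i1, i1) (i0, i0); have N4 := SN (i1, i0) (i0, i1).
have N5 := SN (i1, i1) (i0, i1); have N6 := SN (i1, i1) (i1, i0).
have SC' a b : S a b i1 i0 = S a b i0 i1 by [].
have ricE a b : \sum_(c : vidx) \sum_(d : vidx)
     geps c d * (S a c b.1 d.1 * eps b.2 d.2)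
   = S a (i0, i0) b.1 i1 * eps b.2 i1 - S a (i0, i1) b.1 i1 * eps b.2 i0
   - S a (i1, i0) b.1 i0 * eps b.2 i1 + S a (i1, i1) b.1 i0 * eps b.2 i0.
  rewrite !big_vidx /geps /= !epsE; ring.
have Q a b : _ = 0 := etrans (esym (ricE a b)) (ric a b).
have q0000 := Q (i0, i0) (i0, i0); have q0001 := Q (i0, i0) (i0, i1).
have q0010 := Q (i0, i0) (i1, i0); have q0011 := Q (i0, i0) (i1, i1).
have q0100 := Q (i0, i1) (i0, i0); have q0101 := Q (i0, i1) (i0, i1).
have q0110 := Q (i0, i1) (i1, i0); have q0111 := Q (i0, i1) (i1, i1).
have q1000 := Q (i1, i0) (i0, i0); have q1001 := Q (i1, i0) (i0, i1).
have q1010 := Q (i1, i0) (i1, i0); have q1011 := Q (i1, i0) (i1, i1).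
have q1110 := Q (i1, i1) (i1, i0); have q1111 := Q (i1, i1) (i1, i1).
rewrite /= !S0 !(SC', N1, N2, N3, N4, N5, N6) !epsE in q0000 q0001 q0010 q0011
  q0100 q0101 q0110 q0111 q1000 q1001 q1010 q1011 q1110 q1111.
(* Six index pairs ab and three symmetric pairs DE give 18 components. These 13 relations leave 5,
   the number of components of a totally symmetric four-index spinor. *)
have s5_00 : S (i0, i0) (i1, i0) i0 i0 = 0 by apply: (lincomb (scale_eq (-1) q0000)); ring.
have s5_01 : S (i0, i0) (i1, i0) i0 i1 = 0 by apply: (lincomb (scale_eq (-1) q0010)); ring.
have s5_11 : S (i0, i0) (i1, i0) i1 i1 = 0 by apply: (lincomb (scale_eq (-1) q1010)); ring.
have s6_00 : S (i0, i1) (i1, i1) i0 i0 = 0 by apply: (lincomb (scale_eq (-1) q0101)); ring.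
have s6_01 : S (i0, i1) (i1, i1) i0 i1 = 0 by apply: (lincomb (scale_eq (-1) q0111)); ring.
have s6_11 : S (i0, i1) (i1, i1) i1 i1 = 0 by apply: (lincomb (scale_eq (-1) q1111)); ring.
have s1_01 : S (i0, i0) (i0, i1) i0 i1 = S (i0, i0) (i1, i1) i0 i0 by apply: (lincomb q0001); ring.
have s1_11 : S (i0, i0) (i0, i1) i1 i1 = S (i0, i0) (i1, i1) i0 i1 by apply: (lincomb q0011); ring.
have s2_01 : S (i1, i0) (i1, i1) i0 i1 = S (i0, i0) (i1, i1) i1 i1 by apply: (lincomb q1110); ring.
have s4_00 : S (i0, i1) (i1, i0) i0 i0 = - S (i0, i0) (i1, i1) i0 i0.
  by apply: (lincomb (add_eq (scale_eq (-1) q0001) (scale_eq (-1) q0100))); ring.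
have s4_01 : S (i0, i1) (i1, i0) i0 i1 = - S (i0, i0) (i1, i1) i0 i1.
  by apply: (lincomb (add_eq (scale_eq (-1) q0011) (scale_eq (-1) q0110))); ring.
have s4_11 : S (i0, i1) (i1, i0) i1 i1 = - S (i0, i0) (i1, i1) i1 i1.
  by apply: (lincomb (add_eq (scale_eq (-1) q1011) (scale_eq (-1) q1110))); ring.
have s2_00 : S (i1, i0) (i1, i1) i0 i0 = S (i0, i0) (i1, i1) i0 i1.
  by apply: (lincomb (add_eq (scale_eq (-1) q1001) (scale_eq (-1) s4_01))); ring.
pose sE := (S0, SC', N1, N2, N3, N4, N5, N6,
  (s5_00, s5_01, s5_11, s6_00, s6_01, s6_11),
  (s1_01, s1_11, s2_01, s4_00, s4_01, s4_11, s2_00)).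
pose T A B D E := (\sum_(A' < 2) \sum_(B' < 2)
       eps A' B' * S (A, A') (B, B') D E) / 2%:R.
(* Antisymmetry in the primed indices: S is anti-self-dual in ab. *)
have SX A B D E : S (A, i1) (B, i0) D E = - S (A, i0) (B, i1) D E.
  by elim/I2_ind: A; elim/I2_ind: B; elim/I2_ind: D; elim/I2_ind: E;
     rewrite ?sE ?opprK.
have TE A B D E : T A B D E = S (A, i0) (B, i1) D E.
  by rewrite /T !big_I2 !epsE SX; field.
have h1 A B D E : T A B D E = T B A D E.
  by rewrite !TE; elim/I2_ind: A; elim/I2_ind: B;
     elim/I2_ind: D; elim/I2_ind: E; rewrite ?sE ?oppr0 ?opprK.
have h3 A B D E : T A B D E = T A B E D by rewrite !TE !(SC _ _ D).
have h2 A B D E : T A B D E = T A D B E.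
  by rewrite !TE; elim/I2_ind: A; elim/I2_ind: B;
     elim/I2_ind: D; elim/I2_ind: E; rewrite ?sE ?oppr0 ?opprK.
move=> a b D E; rewrite -/T (sym4_id h1 h2 h3) TE.
elim/vidx_ind: a; elim/vidx_ind: b; elim/I2_ind: D; elim/I2_ind: E;
  rewrite /= ?sE !epsE ?mul0r ?mul1r ?mulN1r ?oppr0 ?opprK //.
Qed.

(** * Spin curvature of a Ricci-flat hyper-Kaehler metric *)

Section CurvatureFacts.
Context (R : realType) (M : topologicalType) (X : atlas R M).
Local Notation C := R[i].
Context (g : metric X) (e : spin_frames g) (nab : spin_connection e).
Implicit Types (i : cindex X) (p : M) (a b : vidx) (f h : M -> C).

(** A connection that keeps eps parallel is sl(2)-valued. *)
Lemma sconn_trace i p a : dom X i p ->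
  sconn nab i p a i1 i1 = - sconn nab i p a i0 i0.
Proof.
move=> dp; have := sconn_eps nab dp a i0 i1; rewrite !big_I2 !epsE => h.
by apply: (lincomb h); ring.
Qed.

Lemma sconn'_trace i p a : dom X i p ->
  sconn' nab i p a i1 i1 = - sconn' nab i p a i0 i0.
Proof.
move=> dp; have := sconn'_eps nab dp a i0 i1; rewrite !big_I2 !epsE => h.
by apply: (lincomb h); ring.
Qed.

Lemma curv_trace (G : M -> vidx -> 'I_2 -> 'I_2 -> C) i p a b :
  (forall a A B, cdiff X i p (fun q => G q a A B)) ->
  (forall q, dom X i q -> forall a, G q a i1 i1 = - G q a i0 i0) ->
  dom X i p -> curv nab G i p a b i1 i1 = - curv nab G i p a b i0 i0.
Proof.
move=> dG trG dp.
have F a' b' : fderiv e i a' (fun q => G q b' i1 i1) p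
             = - fderiv e i a' (fun q => G q b' i0 i0) p.
  rewrite -fderivN //.
  by apply: eq_fderiv => // q /trG.
rewrite /curv !F !big_I2 !big_vidx !trG //; ring.
Qed.

Lemma curv_anti (G : M -> vidx -> 'I_2 -> 'I_2 -> C) i p a b A B :
  curv nab G i p a b A B = - curv nab G i p b a A B.
Proof. by rewrite /curv /tors !big_I2 !big_vidx; ring. Qed.

Lemma spin_curvE i p a b A :
  (spin_curv nab i p a b A i0 = - curv nab (sconn nab i) i p a b A i1) *
  (spin_curv nab i p a b A i1 = curv nab (sconn nab i) i p a b A i0).
Proof.
have E B : spin_curv nab i p a b A B
  = \sum_(D < 2) curv nab (sconn nab i) i p a b A D * eps D B by [].
by split; rewrite E big_I2 !epsE; ring.
Qed.

Lemma spin_curv_anti i p a b A B :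
  spin_curv nab i p a b A B = - spin_curv nab i p b a A B.
Proof.
by elim/I2_ind: B; rewrite !spin_curvE curv_anti.
Qed.

Lemma spin_curv_sym i p a b A B : dom X i p ->
  spin_curv nab i p a b A B = spin_curv nab i p a b B A.
Proof.
move=> dp; have T := curv_trace a b (fun c C D => csmooth_cdiff (sconn_smooth nab i c C D) dp)
  (fun q dq a => sconn_trace a dq) dp.
by elim/I2_ind: A; elim/I2_ind: B; rewrite !spin_curvE // T opprK.
Qed.

(** Here phi_A'^B' is a field on pairs of primed indices with vanishing covariant derivative on the
    whole chart domain; the Ricci identity then makes the curvature commute with it. *)
Lemma parallel_curv' i (phi : M -> 'I_2 -> 'I_2 -> C) p a b A B :
  (forall A B, csmooth X i (fun q => phi q A B)) ->
  (forall q, dom X i q -> forall a A B,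
     fderiv e i a (fun q => phi q A B) q
     = \sum_(D < 2) (sconn' nab i q a A D * phi q D B
                     - phi q A D * sconn' nab i q a D B)) ->
  dom X i p ->
  \sum_(D < 2) curv nab (sconn' nab i) i p a b A D * phi p D B
  = \sum_(D < 2) phi p A D * curv nab (sconn' nab i) i p a b D B.
Proof.
move=> sphi par dp.
pose G := sconn' nab i.
(* The upper index of phi carries the dual connection, whose curvature is minus the transpose
   ([c2]). *)
pose G2 q a A B := - sconn' nab i q a B A.
have dG a' A' B' : cdiff X i p (fun q => G q a' A' B').
  by apply: csmooth_cdiff => //; exact: sconn'_smooth.
have dG2 a' A' B' : cdiff X i p (fun q => G2 q a' A' B') by exact: cdiffN.
pose V q (c : vidx) := phi q c.1 c.2.
have cv0 a' c q : dom X i q ->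
    covd e (fun q => vconn (G q) (G2 q)) V i a' c q = 0.
  move=> dq; rewrite /covd /V par // big_vidx !big_I2 /vconn /G /G2.
  by elim/vidx_ind: c; rewrite /= ?eqxx ?eq01 /=; ring.
have dA a' c d : cdiff X i p (fun q => vconn (G q) (G2 q) a' c d) by exact: cdiff_vconn.
have ric := ricci_identity nab a b (A, B) dA (fun c => sphi c.1 c.2) dp.
have f0 a' b' : fderiv e i a' (covd e (fun q => vconn (G q) (G2 q)) V i b' (A, B)) p = 0.
  rewrite (@eq_fderiv _ _ _ _ e i a' _ (fun=> 0) p dp) ?fderiv_cst // => q.
  exact: cv0.
move: ric; rewrite -/V !f0.
under eq_bigr => d _ do rewrite cv0 // mulr0.
under [X in _ - (_ - X)]eq_bigr => d _ do rewrite cv0 // mulr0.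
under [X in _ - X = _]eq_bigr => d _ do rewrite cv0 // mulr0.
rewrite !big1_eq !subr0.
under eq_bigr => d _ do rewrite curv_vconn //.
have c2 A' B' : curv nab G2 i p a b A' B' = - curv nab G i p a b B' A'.
  rewrite /curv /G2 /G !fderivN //; try exact: dG.
  by rewrite !big_I2 !big_vidx; ring.
move=> /esym/eqP; rewrite oppr_eq0 => /eqP.
rewrite big_vidx !big_I2 /V !c2 -/G => h.
by apply: (lincomb h); elim/I2_ind: A {f0 h}; elim/I2_ind: B; rewrite /= ?eqxx ?eq01 /=; ring.
Qed.

(** Extracts phi from J_a^b = delta_A^B phi_A'^B' as a component of J, so that it inherits
    smoothness; [self_dual_end] provides phi only pointwise. *)
Definition sd_part (J : cindex X -> M -> vidx -> vidx -> C) i q (A B : 'I_2) : C :=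
  J i q (i0, A) (i0, B).

Lemma sd_partE J i q a b : sd_complex_structure nab J -> dom X i q ->
  J i q a b = (a.1 == b.1)%:R * sd_part J i q a.2 b.2.
Proof.
move=> [_ sdJ] dq; have [_ _ [phi Jphi] _] := sdJ i q dq.
by rewrite /sd_part !Jphi /= mul1r.
Qed.

Lemma end_comp_sd_part J K i q A B : sd_complex_structure nab J ->
  sd_complex_structure nab K -> dom X i q ->
  end_comp (K i q) (J i q) (i0, A) (i0, B)
  = \sum_(D < 2) sd_part J i q A D * sd_part K i q D B.
Proof.
move=> sJ sK dq; rewrite /end_comp; under eq_bigr => b _ do
  rewrite (sd_partE _ _ sJ dq) (sd_partE _ _ sK dq).
by rewrite big_vidx !big_I2 /= ?eqxx ?eq01; ring.
Qed.

Lemma sd_part_parallel J i q a A B : sd_complex_structure nab J -> dom X i q ->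
  fderiv e i a (fun q => sd_part J i q A B) q
  = \sum_(D < 2) (sconn' nab i q a A D * sd_part J i q D B
                  - sd_part J i q A D * sconn' nab i q a D B).
Proof.
move=> sJ dq; have [_ _ _ /(_ a (i0, A) (i0, B))] := sJ.2 i q dq.
rewrite /nabla_end; under eq_bigr => d _ do rewrite !(sd_partE _ _ sJ dq).
rewrite /gam /vconn big_vidx !big_I2 /= ?eqxx ?eq01 => h.
apply: (lincomb h); rewrite /sd_part.
elim/I2_ind: A {h}; elim/I2_ind: B; rewrite /= ?eqxx ?eq01; ring.
Qed.

Lemma hyperkahler_curv' i p a b A B : hyperkahler nab -> dom X i p ->
  curv nab (sconn' nab i) i p a b A B = 0.
Proof.
move=> [I [J [K [sI sJ _ IJ]]]] dp.
pose F := \matrix_(A, B) curv nab (sconn' nab i) i p a b A B.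
pose mx L := \matrix_(A, B) sd_part L i p A B.
have commF L : sd_complex_structure nab L -> F * mx L = mx L * F.
  move=> sL; apply/matrixP => A' B'; rewrite !mxE.
  under eq_bigr do rewrite !mxE; under [RHS]eq_bigr do rewrite !mxE.
  apply: parallel_curv' => //.
    by move=> A1 B1; have [[sm _ _] _] := sL; exact: sm.
  by move=> q dq c A1 B1; exact: sd_part_parallel.
have mx2 L : sd_complex_structure nab L -> mx L * mx L = -1.
  move=> sL; apply/matrixP => A' B'; rewrite !mxE.
  under eq_bigr do rewrite !mxE.
  rewrite -end_comp_sd_part //; have [-> _ _ _] := sL.2 i p dp.
  by rewrite xpair_eqE eqxx.
(* [end_comp] applies its second argument first, so the matrices multiply in reverse order. *)
have anti : mx I * mx J = - (mx J * mx I).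
  apply/matrixP => A' B'; rewrite !mxE.
  under eq_bigr do rewrite !mxE; under [in RHS]eq_bigr do rewrite !mxE.
  by rewrite -!end_comp_sd_part //; have [-> ->] := IJ i p dp (i0, A') (i0, B').
have trF : \tr F = 0.
  rewrite /mxtrace big_I2 !mxE (@curv_trace (sconn' nab i)) ?subrr //.
  - by move=> c A' B'; apply: csmooth_cdiff => //; exact: sconn'_smooth.
  - by move=> q dq c; exact: sconn'_trace.
have F0 := quaternion_centralizer (mx2 I sI) (mx2 J sJ) anti trF (commF I sI) (commF J sJ).
by move/matrixP/(_ A B): F0; rewrite !mxE.
Qed.

Lemma ricci_flat_spin_curv i p a b A B : hyperkahler nab ->
  (forall a b, ricci nab i p a b = 0) -> dom X i p ->
  spin_curv nab i p a b A B = eps a.2 b.2 * Weyl_asd nab i p a.1 b.1 A B.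
Proof.
move=> hk ric dp; apply: ricci_flat_weyl => {a b A B}.
- exact: spin_curv_anti.
- by move=> *; exact: spin_curv_sym.
- move=> a b; apply: etrans (ric a b); apply: eq_bigr => c _; apply: eq_bigr => d _.
  (* The primed half of the Riemann tensor vanishes, so the Ricci tensor is the trace of the
     unprimed half alone. *)
  rewrite /riemann [X in _ = _ * (_ + X * _)](_ : _ = 0) ?mul0r ?addr0 //.
  apply: big1 => D _; apply: etrans (mul0r (eps D d.2)); congr (_ * _).
  exact: hyperkahler_curv'.
Qed.

End CurvatureFacts.

(** * Spinor identities at a point *)

Section SpinorIdentities.
Context (R : realType).
Local Notation C := R[i].
Implicit Types (s chi : 'I_2 -> 'I_2 -> C) (v w : C) (x : vidx -> C).

Definition det2 s : C := s i0 i0 * s i1 i1 - s i0 i1 * s i1 i0.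

Lemma snorm2E s : snorm2 s = 2%:R * det2 s.
Proof. by rewrite /snorm2 /det2 !big_I2 !epsE; ring. Qed.

Lemma type_D_weyl (o l : 'I_2 -> C) w s A B D E : w != 0 ->
  (forall A B, s A B = 2%:R * 'i%C * w^-1 * sym2 (fun F G => o F * l G) A B) ->
  6%:R * w ^+ 3 * sym4 (fun F G H K => o F * o G * l H * l K) A B D E
  = - (w ^+ 5 * (s A B * s D E + s A D * s B E + s A E * s B D) / 2%:R).
Proof.
move=> w0 sE.
pose k : C := 'i%C * w^-1.
have sE' A' B' : s A' B' = k * (o A' * l B' + o B' * l A').
  by rewrite sE /sym2 /k; field.
have kE : w ^+ 5 * k ^+ 2 = - w ^+ 3.
  by rewrite /k exprMn sqr_i; field.
rewrite !sE' /sym4 /sym3 /sym2.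
set Q := (X in _ = X).
have -> : Q = - (w ^+ 5 * k ^+ 2 * ((o A * l B + o B * l A) * (o D * l E + o E * l D)
   + (o A * l D + o D * l A) * (o B * l E + o E * l B)
   + (o A * l E + o E * l A) * (o B * l D + o D * l B)) / 2%:R) by rewrite /Q; ring.
by rewrite kE; field.
Qed.

(** The hypothesis is the Ricci identity for sigma, an overdetermined linear system for the 16
    components of N = nabla xi that leaves only chi free. As chi comes out symmetric, N is
    antisymmetric: that xi is Killing is a conclusion here. *)
Lemma killing_spinor_gradient (N : vidx -> vidx -> C) s v :
  (forall A B, s A B = s B A) ->
  (forall a b D E,
     eps b.1 D * N a (E, b.2) + eps b.1 E * N a (D, b.2)
     - (eps a.1 D * N b (E, a.2) + eps a.1 E * N b (D, a.2))
     = - (eps a.2 b.2 * v * (eps a.1 D * s b.1 E + eps b.1 D * s a.1 E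
                          + eps a.1 E * s b.1 D + eps b.1 E * s a.1 D) / 2%:R)) ->
  let chi A' B' := (\sum_(A < 2) \sum_(B < 2) eps A B * N (A, A') (B, B')) / 2%:R in
  (forall A' B', chi A' B' = chi B' A') /\
  forall a b, N a b = - (v * s a.1 b.1 * eps a.2 b.2 / 2%:R)
                      + eps a.1 b.1 * chi a.2 b.2.
Proof.
move=> sC H chi.
have chiE A' B' : chi A' B' = (N (i0, A') (i1, B') - N (i1, A') (i0, B')) / 2%:R.
  by rewrite /chi !big_I2 !epsE; congr (_ / _); ring.
have Q A A' B B' D E := H (A, A') (B, B') D E; move: Q => /= Q.
(* The digits list the values of A, A', B, B', D, E. *)
have q001000 := Q i0 i0 i1 i0 i0 i0; have q001100 := Q i0 i0 i1 i1 i0 i0.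
have q001001 := Q i0 i0 i1 i0 i0 i1; have q000111 := Q i0 i0 i0 i1 i1 i1.
have q011001 := Q i0 i1 i1 i0 i0 i1; have q000101 := Q i0 i0 i0 i1 i0 i1.
have q011100 := Q i0 i1 i1 i1 i0 i0; have q001101 := Q i0 i0 i1 i1 i0 i1.
have q011101 := Q i0 i1 i1 i1 i0 i1; have q001011 := Q i0 i0 i1 i0 i1 i1.
have q011011 := Q i0 i1 i1 i0 i1 i1; have q001111 := Q i0 i0 i1 i1 i1 i1.
have q011111 := Q i0 i1 i1 i1 i1 i1.
rewrite !epsE !(sC i1 i0) in q001000 q001100 q001001 q000111 q011001 q000101
  q011100 q001101 q011101 q001011 q011011 q001111 q011111.
split.
  have c01 : chi i0 i1 = chi i1 i0.
    rewrite !chiE; apply: (lincomb (add_eq (scale_eq (- 2%:R^-1) q001101)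
      (scale_eq (2%:R^-1) q011001))); by field.
  by move=> A B; elim/I2_ind: A; elim/I2_ind: B.
move=> a b; rewrite chiE.
elim/vidx_ind: a; elim/vidx_ind: b => /=; rewrite !epsE ?(sC i1 i0).
- apply: (lincomb (scale_eq (- 2%:R^-1) q001000)); by field.
- apply: (lincomb (scale_eq (- 2%:R^-1) q001100)); by field.
- apply: (lincomb (scale_eq (- 2%:R^-1) q001001)); by field.
- apply: (lincomb (add_eq (scale_eq (4%:R^-1) q000111) (scale_eq (- 2%:R^-1) q011001))); by field.
- apply: (lincomb (add_eq (scale_eq (- 2%:R^-1) q001100) (scale_eq (-1) q000101))); by field.
- apply: (lincomb (scale_eq (- 2%:R^-1) q011100)); by field.
- apply: (lincomb (add_eq (scale_eq (- 2%:R^-1) q001101) (scale_eq (- 4%:R^-1) q000111))); by field.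
- apply: (lincomb (scale_eq (- 2%:R^-1) q011101)); by field.
- apply: (lincomb (scale_eq (- 2%:R^-1) q001001)); by field.
- apply: (lincomb (add_eq (scale_eq (4%:R^-1) q000111) (scale_eq (- 2%:R^-1) q011001))); by field.
- apply: (lincomb (scale_eq (- 2%:R^-1) q001011)); by field.
- apply: (lincomb (scale_eq (- 2%:R^-1) q011011)); by field.
- apply: (lincomb (add_eq (scale_eq (- 2%:R^-1) q001101) (scale_eq (- 4%:R^-1) q000111))); by field.
- apply: (lincomb (scale_eq (- 2%:R^-1) q011101)); by field.
- apply: (lincomb (scale_eq (- 2%:R^-1) q001111)); by field.
- apply: (lincomb (scale_eq (- 2%:R^-1) q011111)); by field.
Qed.

(** Contracting the second hypothesis with eps^BD gives 2 P_AA'B'D' = P_AB'A'D', and doing so twice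
    gives 4 P = P. Below, the vanishing is read off component by component. *)
Lemma sd_gradient_eq0 (P : vidx -> 'I_2 -> 'I_2 -> C) :
  (forall a A' B', P a A' B' = P a B' A') ->
  (forall a b D D', eps b.1 D * P a b.2 D' = eps a.1 D * P b a.2 D') ->
  forall a A' B', P a A' B' = 0.
Proof.
move=> PC H.
have Q A A' B B' D D' := H (A, A') (B, B') D D'; move: Q => /= Q.
have q001000 := Q i0 i0 i1 i0 i0 i0; have q001001 := Q i0 i0 i1 i0 i0 i1.
have q001101 := Q i0 i0 i1 i1 i0 i1; have q000110 := Q i0 i0 i0 i1 i1 i0.
have q000111 := Q i0 i0 i0 i1 i1 i1; have q011101 := Q i0 i1 i1 i1 i0 i1.
have q001010 := Q i0 i0 i1 i0 i1 i0; have q001011 := Q i0 i0 i1 i0 i1 i1.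
have q011011 := Q i0 i1 i1 i0 i1 i1; have q001110 := Q i0 i0 i1 i1 i1 i0.
have q001111 := Q i0 i0 i1 i1 i1 i1; have q011111 := Q i0 i1 i1 i1 i1 i1.
rewrite !epsE !(PC _ i1 i0) in q001000 q001001 q001101 q000110 q000111 q011101
  q001010 q001011 q011011 q001110 q001111 q011111.
have S a : P a i0 i0 = 0 -> P a i0 i1 = 0 -> P a i1 i1 = 0 ->
    forall A' B', P a A' B' = 0.
  by move=> h1 h2 h3 A' B'; elim/I2_ind: A'; elim/I2_ind: B' => //; rewrite PC.
elim/vidx_ind; apply: S.
- apply: (lincomb (scale_eq (-1) q001000)); ring.
- apply: (lincomb (scale_eq (-1) q001001)); ring.
- apply: (lincomb (scale_eq (-1) q001101)); ring.
- apply: (lincomb (add_eq (scale_eq (-1) q001001) (scale_eq (-1) q000110))); ring.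
- apply: (lincomb (add_eq (scale_eq (-1) q001101) (scale_eq (-1) q000111))); ring.
- apply: (lincomb (scale_eq (-1) q011101)); ring.
- apply: (lincomb (scale_eq (-1) q001010)); ring.
- apply: (lincomb (scale_eq (-1) q001011)); ring.
- apply: (lincomb (scale_eq (-1) q011011)); ring.
- apply: (lincomb (scale_eq (-1) q001110)); ring.
- apply: (lincomb (scale_eq (-1) q001111)); ring.
- apply: (lincomb (scale_eq (-1) q011111)); ring.
Qed.

End SpinorIdentities.

(** * The closed system as polynomial identities at a point *)

Section PointwiseIdentities.
Context (R : realType).
Local Notation C := R[i].
Context (s chi : 'I_2 -> 'I_2 -> C) (x : vidx -> C) (u : C).
Context (sC : forall A B, s A B = s B A).
Context (chiC : forall A B, chi A B = chi B A).

Let s10 : s i1 i0 = s i0 i1 := sC i1 i0.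
Let chi10 : chi i1 i0 = chi i0 i1 := chiC i1 i0.

(** The gradient nabla_a sigma_BD prescribed by the Killing spinor equation. *)
Definition dsigma (a : vidx) (B D : 'I_2) : C :=
  eps a.1 B * x (D, a.2) + eps a.1 D * x (B, a.2).

Definition ddet a : C :=
  dsigma a i0 i0 * s i1 i1 + s i0 i0 * dsigma a i1 i1
  - 2%:R * (s i0 i1 * dsigma a i0 i1).

(* W_ABD^E *)
Definition weyl_end (W : 'I_2 -> 'I_2 -> 'I_2 -> 'I_2 -> C) A B D (E : 'I_2) : C :=
  if E == i0 then W A B D i1 else - W A B D i0.

(** For symmetric s, s_AC s_BE eps^CE = det(s) eps_AB, so the cubic expression collapses to det(s)
    times s. This is how Omega^5 later becomes Omega^3. *)
Lemma weyl_end_sigma A B D E :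
  let W A B D E := s A B * s D E + s A D * s B E + s A E * s B D in
  \sum_(f < 2) (weyl_end W A B D f * s f E + weyl_end W A B E f * s D f)
  = - det2 s * (eps A D * s B E + eps B D * s A E + eps A E * s B D + eps B E * s A D).
Proof.
move=> W; rewrite big_I2 /weyl_end /det2 /W /=.
by elim/I2_ind: A; elim/I2_ind: B; elim/I2_ind: D; elim/I2_ind: E;
  rewrite !epsE ?s10; ring.
Qed.

(** Times Omega^5 / 4, [dphi] is the gradient of Omega^3 sigma / 2, which is up to sign the
    anti-self-dual part of nabla xi. It accounts for the whole Weyl term in the Ricci identity for
    xi, so that nothing is left for nabla chi. *)
Lemma weyl_end_xi a b c :
  let W A B D E := s A B * s D E + s A D * s B E + s A E * s B D in
  let dphi a B D := 2%:R * det2 s * dsigma a B D - 3%:R * ddet a * s B D in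
  dphi a b.1 c.1 * eps b.2 c.2 - dphi b a.1 c.1 * eps a.2 c.2
  = - 2%:R * eps a.2 b.2 * \sum_(f < 2) weyl_end W a.1 b.1 c.1 f * x (f, c.2).
Proof.
move=> W dphi; rewrite /dphi big_I2 /weyl_end /ddet /dsigma /det2 /W /=.
elim/vidx_ind: a; elim/vidx_ind: b; elim/vidx_ind: c => /=;
  rewrite !epsE ?s10; ring.
Qed.

(* [u] stands for Omega^3 / 2.  As Omega = Omega^3 det sigma, writing
   [u * det2 s] for Omega / 2 makes all identities below polynomial. *)
Definition dxi a b : C := eps a.1 b.1 * chi a.2 b.2 - u * s a.1 b.1 * eps a.2 b.2.

(* Half the gradient of E_+ *)
Definition halfdE a : C := \sum_b eps a.1 b.1 * chi a.2 b.2 * vraise x b.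

(* E_+ / 2 *)
Definition halfE : C :=
  u * det2 s + (x (i0, i0) * x (i1, i1) - x (i0, i1) * x (i1, i0)).

Definition Hs a b : C := s a.1 b.1 * chi a.2 b.2 - halfE * geps a b.

Definition dH a b c : C :=
  dsigma a b.1 c.1 * chi b.2 c.2 - halfdE a * geps b c.

Definition ts a : C := \sum_b Hs a b * vraise x b.

Definition dt a b : C := \sum_c (dH a b c * vraise x c + Hs b c * vraise (dxi a) c).

Lemma vraiseE (y : vidx -> C) :
  (vraise y (i0, i0) = y (i1, i1)) * (vraise y (i0, i1) = - y (i1, i0)) *
  ((vraise y (i1, i0) = - y (i0, i1)) * (vraise y (i1, i1) = y (i0, i0))).
Proof. by rewrite /vraise !big_vidx /geps /= !epsE; do !split; ring. Qed.

(** The u term comes from the anti-self-dual part of nabla xi; half the gradient of Omega, which is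
    - u ddet / 2, cancels it in E_+ / 2. *)
Lemma halfdE_eq a :
  \sum_b vraise x b * dxi a b = halfdE a + u / 2%:R * ddet a.
Proof.
rewrite /halfdE !big_vidx !vraiseE /dxi /ddet /dsigma.
by elim/vidx_ind: a => /=; rewrite !epsE ?s10; field.
Qed.

(** Under symmetrisation a factor eps_AB forces antisymmetry in A'B', hence a factor eps_A'B'. The
    gradient of sigma thus contributes g_ab times a contraction of chi with xi, which [halfdE]
    cancels. *)
Lemma H_killing a b c :
  dH a b c + dH a c b + (dH b a c + dH b c a) + (dH c a b + dH c b a) = 0.
Proof.
rewrite /dH /halfdE !big_vidx !vraiseE /dsigma /geps.
by elim/vidx_ind: a; elim/vidx_ind: b; elim/vidx_ind: c => /=;
  rewrite !epsE ?chi10; ring.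
Qed.

(** By [H_killing] the left side is - xi^c nabla_c H_ab plus a commutator of H with nabla xi, and
    both vanish. *)
Lemma t_killing a b : dt a b + dt b a = 0.
Proof.
rewrite /dt !big_vidx !vraiseE /dH /Hs /dxi /halfdE !big_vidx !vraiseE
  /halfE /det2 /dsigma /geps.
by elim/vidx_ind: a; elim/vidx_ind: b => /=; rewrite !epsE ?chi10 ?s10; ring.
Qed.

(** All self-dual terms are multiples of chi. The Omega half of E_+ cancels the product of sigma chi
    with Omega^3 sigma, and the xi_b xi^b half cancels the contribution of nabla H. *)
Lemma t_asd A' B' :
  \sum_(A < 2) \sum_(B < 2) eps A B * dt (A, A') (B, B') = 0.
Proof.
rewrite !big_I2 !epsE /dt !big_vidx !vraiseE /dH /Hs /dxi /halfdE !big_vidx !vraiseE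
  /halfE /det2 /dsigma /geps.
by elim/I2_ind: A'; elim/I2_ind: B' => /=; rewrite !epsE ?chi10 ?s10; ring.
Qed.

(** As xi^a nabla_a H = 0, this is the commutator of H and nabla xi applied to xi. *)
Lemma t_commutes b :
  \sum_a (vraise ts a * dxi a b - vraise x a * dt a b) = 0.
Proof.
rewrite big_vidx !vraiseE /ts /dt !big_vidx !vraiseE /dH /Hs /dxi /halfdE !big_vidx !vraiseE
  /halfE /det2 /dsigma /geps.
by elim/vidx_ind: b => /=; rewrite !epsE ?chi10 ?s10; ring.
Qed.

End PointwiseIdentities.

(** * Covariant derivatives *)

Section TensorCalculus.
Context (R : realType) (M : topologicalType) (X : atlas R M).
Local Notation C := R[i].
Context (g : metric X) (e : spin_frames g) (nab : spin_connection e).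
Implicit Types (i : cindex X) (p : M) (a b : vidx) (f h : M -> C).

(** [gam] is metric, that is, antisymmetric once its last index is lowered; hence the sign. *)
Lemma vraise_gam i p a (y : vidx -> C) c : dom X i p ->
  vraise (fun b => \sum_(d : vidx) gam nab i p a b d * y d) c
  = - \sum_(b : vidx) vraise y b * gam nab i p a b c.
Proof.
move=> dp; rewrite big_vidx.
elim/vidx_ind: c; rewrite !vraiseE !big_vidx /gam /vconn /=
  !(sconn_trace nab _ dp, sconn'_trace nab _ dp); ring.
Qed.

Lemma cdiff_vraise i p (V : M -> vidx -> C) a :
  (forall c, cdiff X i p (fun q => V q c)) -> cdiff X i p (fun q => vraise (V q) a).
Proof. by move=> dV; apply: cdiff_sum => b; exact: cdiffZ. Qed.

Lemma vec_coord_deriv i (V : M -> vidx -> C) p (f : M -> C) :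
  \sum_(n < 4) vec_coord e i V p n * cpartial X i n f p
  = \sum_a vraise (V p) a * fderiv e i a f p.
Proof.
rewrite /vec_coord; under eq_bigr => n _ do rewrite mulr_suml.
rewrite exchange_big /=; apply: eq_bigr => a _.
by rewrite mulr_sumr; apply: eq_bigr => n _; rewrite mulrA.
Qed.

Lemma fderiv_vraise i (V : M -> vidx -> C) p a b : dom X i p ->
  (forall c, cdiff X i p (fun q => V q c)) ->
  fderiv e i a (fun q => vraise (V q) b) p
  = vraise (fun c => fderiv e i a (fun q => V q c) p) b.
Proof.
move=> dp dV; rewrite /vraise fderiv_sum; last by move=> c; exact: cdiffZ.
by apply: eq_bigr => c _; rewrite fderivZ.
Qed.

(** Vanishing torsion: [K] collects the derivatives of the frame, which [sconn_torsion] turns into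
    connection terms ([KK]); added to the derivatives of the components in [L], they form the
    covariant derivatives. *)
Lemma lie_bracket_vec_coord i (V W : M -> vidx -> C) p m : dom X i p ->
  (forall c, cdiff X i p (fun q => V q c)) ->
  (forall c, cdiff X i p (fun q => W q c)) ->
  lie_bracket X i (vec_coord e i V) (vec_coord e i W) p m
  = \sum_c vraise (fun b => \sum_a (vraise (V p) a * nabla_v nab i W p a b
                            - vraise (W p) a * nabla_v nab i V p a b)) c
           * frame e i p c m.
Proof.
move=> dp dV dW.
pose K (V W : M -> vidx -> C) := \sum_a \sum_b vraise (V p) a * vraise (W p) b
    * fderiv e i a (fun q => frame e i q b m) p.
pose L (V W : M -> vidx -> C) c := \sum_a vraise (V p) a
    * vraise (fun b => fderiv e i a (fun q => W q b) p) c.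
have dF a q : dom X i q -> cdiff X i q (fun q => frame e i q a m).
  exact: cdiff_frame.
have E (V' W' : M -> vidx -> C) : (forall c, cdiff X i p (fun q => W' q c)) ->
    \sum_(n < 4) vec_coord e i V' p n * cpartial X i n (fun q => vec_coord e i W' q m) p
    = K V' W' + \sum_c L V' W' c * frame e i p c m.
  move=> dW'; rewrite vec_coord_deriv /L.
  under [X in _ = _ + X]eq_bigr => c _ do rewrite mulr_suml.
  rewrite [X in _ = _ + X]exchange_big -big_split /=; apply: eq_bigr => a _.
  rewrite /vec_coord fderiv_sum; last first.
    by move=> c; apply: cdiffM; [exact: cdiff_vraise|exact: dF].
  rewrite mulr_sumr -big_split; apply: eq_bigr => c _ /=.
  rewrite fderivM //; [|exact: cdiff_vraise|exact: dF].
  by rewrite fderiv_vraise // mulrDr !mulrA.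
have KK : K V W - K W V = \sum_c (\sum_a \sum_b vraise (V p) a * vraise (W p) b
     * tors nab i p a b c) * frame e i p c m.
  rewrite /K [X in _ - X]exchange_big -sumrB /=.
  under [RHS]eq_bigr => c _ do rewrite mulr_suml.
  rewrite [RHS]exchange_big /=; apply: eq_bigr => a _.
  under [RHS]eq_bigr => c _ do rewrite mulr_suml.
  rewrite [RHS]exchange_big -sumrB /=; apply: eq_bigr => b _.
  rewrite [vraise (W p) b * _]mulrC -mulrBr.
  under [RHS]eq_bigr => c _ do rewrite -mulrA.
  rewrite -mulr_sumr; congr (_ * _); apply: etrans (sconn_torsion nab dp a b m).
  by rewrite /lie_bracket sumrB.
rewrite /lie_bracket sumrB !E // opprD addrACA KK -sumrB -big_split /=.
apply: eq_bigr => c _; rewrite -mulrBl -mulrDl; congr (_ * _).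
have NL (V' W' : M -> vidx -> C) :
   vraise (fun b => \sum_a vraise (V' p) a * nabla_v nab i W' p a b) c
   = L V' W' c + \sum_a \sum_b vraise (V' p) a * vraise (W' p) b * gam nab i p a b c.
  rewrite {1}/vraise; under eq_bigr => b _ do rewrite mulr_sumr.
  rewrite exchange_big -big_split; apply: eq_bigr => a _ /=.
  under eq_bigr => b _ do rewrite mulrCA.
  rewrite -mulr_sumr.
  under [in RHS]eq_bigr => b _ do rewrite -mulrA.
  rewrite -mulr_sumr -mulrDr; congr (_ * _).
  rewrite /nabla_v; under eq_bigr => b _ do rewrite mulrBr.
  by rewrite sumrB -![\sum_b geps c b * _]/(vraise _ c) (vraise_gam a (W' p) c dp) opprK.
rewrite {1}/vraise.
under [RHS]eq_bigr => b _ do rewrite sumrB mulrBr.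
rewrite sumrB -![\sum_b geps c b * _]/(vraise _ c) !NL /tors.
under eq_bigr => a _ do under eq_bigr => b _ do rewrite mulrBr.
under eq_bigr => a _ do rewrite sumrB.
rewrite sumrB [X in _ - X + _]exchange_big /=.
under [X in _ - X + _]eq_bigr => a _ do under eq_bigr => b _ do rewrite [vraise (V p) _ * _]mulrC.
ring.
Qed.

End TensorCalculus.

(** * Gradient of the conformal factor *)

Section ConformalFactor.
Context (R : realType) (M : topologicalType) (X : atlas R M).
Local Notation C := R[i].
Context (g : metric X) (e : spin_frames g).

(** Differentiability comes from w = 1 / sqrt(Re u); the derivative itself from differentiating w w
    u = 1. *)
Lemma fderiv_inv_sqrt (i : cindex X) (w : M -> R) (u : M -> C) p a :
  (forall q, dom X i q -> 0 < w q /\ ((w q) ^- 2)%:C = u q) ->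
  cdiff X i p u -> dom X i p ->
  cdiff X i p (fun q => (w q)%:C) /\
  fderiv e i a (fun q => (w q)%:C) p = - ((w p)%:C ^+ 3 / 2%:R * fderiv e i a u p).
Proof.
move=> wu du dp.
have dw : cdiff X i p (fun q => (w q)%:C).
  split; last exact: differentiable_cst.
  pose ru y := complex.Re (u (chartV X i y)).
  have ruE q : dom X i q -> complex.Re (u q) = (w q) ^- 2 by move=> /wu [_ <-].
  have ru0 : 0 < ru (chart X i p).
    by rewrite /ru chartK // ruE // invr_gt0 exprn_gt0 //; case: (wu p dp).
  apply: (@eq_differentiable _ _ _ (fun y => (Num.sqrt (ru y))^-1) _ _ _ (nbhs_chart dp)).
    move=> y /dom_chartV dy; rewrite /ru ruE //=.
    have [w0 _] := wu _ dy.
    by rewrite -exprVn sqrtr_sqr ger0_norm ?invrK // invr_ge0 ltW.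
  apply: (@differentiableV _ _ (Num.sqrt \o ru)).
    apply: differentiable_comp; first by have [] := du.
    by apply/derivable1_diffP; have [] := is_derive1_sqrt ru0.
  by rewrite /= gt_eqF // sqrtr_gt0.
split=> //.
have E q : dom X i q -> (w q)%:C * (w q)%:C * u q = 1.
  move=> dq; have [_ <-] := wu q dq.
  rewrite -rmorphM -rmorphM /= -expr2 mulfV //.
  by rewrite expf_neq0 // gt_eqF //; case: (wu q dq).
have := eq_fderiv e a dp E; rewrite fderiv_cst.
rewrite fderivM //; last exact: cdiffM.
rewrite fderivM // => h.
have Ep := E p dp.
apply: (lincomb (add_eq (scale_eq ((w p)%:C / 2%:R) h)
                        (scale_eq (- fderiv e i a (fun q => (w q)%:C) p) Ep))).
by field.
Qed.

End ConformalFactor.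

(** * Leibniz rules for contractions and composite tensors *)

Section LeibnizRules.
Context (R : realType) (M : topologicalType) (X : atlas R M).
Local Notation C := R[i].
Context (g : metric X) (e : spin_frames g) (nab : spin_connection e).
Implicit Types (i : cindex X) (p : M) (a b : vidx).

(** The connection terms on the contracted index, one from T and one from the raised V, cancel. *)
Lemma nabla_v_contract i (T : M -> vidx -> vidx -> C) (V : M -> vidx -> C) p a b :
  (forall b c, cdiff X i p (fun q => T q b c)) ->
  (forall c, cdiff X i p (fun q => V q c)) -> dom X i p ->
  nabla_v nab i (fun q b => \sum_c T q b c * vraise (V q) c) p a b
  = \sum_c (nabla_t nab i T p a b c * vraise (V p) c
            + T p b c * vraise (nabla_v nab i V p a) c).
Proof.
move=> dT dV dp; rewrite /nabla_v fderiv_sum; last first.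
  by move=> c; apply: cdiffM => //; exact: cdiff_vraise.
have vN c : vraise (fun b => fderiv e i a (fun q => V q b) p
                       - \sum_(d : vidx) gam nab i p a b d * V p d) c
    = vraise (fun b => fderiv e i a (fun q => V q b) p) c
      + \sum_(b : vidx) vraise (V p) b * gam nab i p a b c.
  rewrite -[X in _ + X]opprK -(vraise_gam nab a (V p) c dp).
  by rewrite /vraise -sumrB; apply: eq_bigr => d _; rewrite mulrBr.
pose T1 c := \sum_d gam nab i p a b d * T p d c.
pose T2 c := \sum_d gam nab i p a c d * T p b d.
have E1 : \sum_c gam nab i p a b c * (\sum_d T p c d * vraise (V p) d)
        = \sum_c T1 c * vraise (V p) c.
  under eq_bigr => c _ do rewrite mulr_sumr.
  rewrite exchange_big; apply: eq_bigr => c _ /=.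
  by rewrite /T1 mulr_suml; apply: eq_bigr => d _; rewrite mulrA.
have E2 : \sum_c T p b c * (\sum_d vraise (V p) d * gam nab i p a d c)
        = \sum_c T2 c * vraise (V p) c.
  under eq_bigr => c _ do rewrite mulr_sumr.
  rewrite exchange_big; apply: eq_bigr => c _ /=.
  rewrite /T2 mulr_suml; apply: eq_bigr => d _; ring.
under [RHS]eq_bigr => c _ do
  rewrite vN /nabla_t big_split /= -/(T1 c) -/(T2 c) mulrBl mulrDl mulrDr.
have dxr c : cdiff X i p (fun q => vraise (V q) c) by exact: cdiff_vraise.
under [X in X - _ = _]eq_bigr => c _ do rewrite fderivM // fderiv_vraise //.
rewrite E1 !big_split /= sumrN !big_split /= E2; ring.
Qed.

(* The next three lemmas regroup frame derivatives and connection terms into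
   covariant derivatives; they hold because the connection is trace-free, that
   is, eps is parallel. *)
Lemma leibniz_dsigma i p a b c (x y : vidx -> C) : dom X i p ->
  eps b.1 c.1 * y (c.2, b.2) + eps b.1 c.2 * y (c.1, b.2)
  - \sum_d vconn (sconn nab i p) (sconn nab i p) a c d * dsigma x b d.1 d.2
  - \sum_d gam nab i p a b d * dsigma x d c.1 c.2
  = eps b.1 c.1 * (y (c.2, b.2) - \sum_d gam nab i p a (c.2, b.2) d * x d)
  + eps b.1 c.2 * (y (c.1, b.2) - \sum_d gam nab i p a (c.1, b.2) d * x d).
Proof.
move=> dp; rewrite !big_vidx /dsigma /gam /vconn /=.
elim/vidx_ind: b; elim/vidx_ind: c => /=;
  rewrite !epsE ?(sconn_trace nab _ dp); ring.
Qed.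

Lemma leibniz_dxi i p a b c (s chi ys ychi : 'I_2 -> 'I_2 -> C) (u yu : C) :
  (forall A B, s A B = s B A) -> (forall A B, chi A B = chi B A) -> dom X i p ->
  eps b.1 c.1 * ychi b.2 c.2 - (u * ys b.1 c.1 + yu * s b.1 c.1) * eps b.2 c.2
  - \sum_d gam nab i p a c d * dxi s chi u b d
  - \sum_d gam nab i p a b d * dxi s chi u d c
  = eps b.1 c.1 * (ychi b.2 c.2
      - \sum_(D < 2) (sconn' nab i p a b.2 D * chi D c.2
                      + sconn' nab i p a c.2 D * chi b.2 D))
    - (u * (ys b.1 c.1 - \sum_(D < 2) (sconn nab i p a b.1 D * s D c.1
                      + sconn nab i p a c.1 D * s b.1 D))
       + yu * s b.1 c.1) * eps b.2 c.2.
Proof.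
move=> sC chiC dp; rewrite !big_vidx !big_I2 /dxi /gam /vconn /=.
have s10 := sC i1 i0; have chi10 := chiC i1 i0.
elim/vidx_ind: b; elim/vidx_ind: c => /=;
  rewrite !epsE ?s10 ?chi10 ?(sconn_trace nab _ dp, sconn'_trace nab _ dp); ring.
Qed.

Lemma leibniz_H i p a b c (s chi ys ychi : 'I_2 -> 'I_2 -> C) (h yh : C) :
  (forall A B, s A B = s B A) -> (forall A B, chi A B = chi B A) -> dom X i p ->
  let H b c := s b.1 c.1 * chi b.2 c.2 - h * geps b c in
  ys b.1 c.1 * chi b.2 c.2 + s b.1 c.1 * ychi b.2 c.2 - yh * geps b c
  - \sum_d (gam nab i p a b d * H d c + gam nab i p a c d * H b d)
  = (ys b.1 c.1 - \sum_(D < 2) (sconn nab i p a b.1 D * s D c.1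
                      + sconn nab i p a c.1 D * s b.1 D)) * chi b.2 c.2
   + s b.1 c.1 * (ychi b.2 c.2
      - \sum_(D < 2) (sconn' nab i p a b.2 D * chi D c.2
                      + sconn' nab i p a c.2 D * chi b.2 D)) - yh * geps b c.
Proof.
move=> sC chiC dp H; rewrite /H !big_vidx !big_I2 /gam /vconn /geps /=.
have s10 := sC i1 i0; have chi10 := chiC i1 i0.
elim/vidx_ind: b; elim/vidx_ind: c => /=;
  rewrite !epsE ?s10 ?chi10 ?(sconn_trace nab _ dp, sconn'_trace nab _ dp); ring.
Qed.

End LeibnizRules.

(** * Killing spinors *)

Section KillingSpinor.
Context (R : realType) (M : topologicalType) (X : atlas R M).
Local Notation C := R[i].
Context (g : metric X) (e : spin_frames g) (nab : spin_connection e).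
Context (i : cindex X) (s : M -> 'I_2 -> 'I_2 -> C) (x : M -> vidx -> C) (Om : M -> R).
Context (s_smooth : forall A B, csmooth X i (fun q => s q A B)).
Context (x_smooth : forall c, csmooth X i (fun q => x q c)).
Context (sC : forall q, dom X i q -> forall A B, s q A B = s q B A).
Context (s_killing : forall q, dom X i q -> forall a B D,
  nabla_s nab i s q a B D = dsigma (x q) a B D).
Context (Om_det : forall q, dom X i q ->
  0 < Om q /\ ((Om q) ^- 2)%:C = det2 (s q)).
Context (s_curv : forall q, dom X i q -> forall a b A f,
  curv nab (sconn nab i) i q a b A f
  = - ((Om q)%:C ^+ 5 / 2%:R * eps a.2 b.2 * weyl_end (fun A B D E =>
        s q A B * s q D E + s q A D * s q B E + s q A E * s q B D) a.1 b.1 A f)).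
Context (curv'0 : forall q, dom X i q -> forall a b A f,
  curv nab (sconn' nab i) i q a b A f = 0).
Implicit Types (p q : M) (a b c : vidx).

Local Notation w q := ((Om q)%:C).
Local Notation D a f q := (fderiv e i a f q).

Definition chi q (A' B' : 'I_2) : C :=
  (\sum_(A < 2) \sum_(B < 2) eps A B * nabla_v nab i x q (A, A') (B, B')) / 2%:R.

Local Notation hu q := (w q ^+ 3 / 2%:R).

Let ds q : dom X i q -> forall A B, cdiff X i q (fun q => s q A B).
Proof. by move=> dq A B; exact: csmooth_cdiff. Qed.

Let dx q : dom X i q -> forall c, cdiff X i q (fun q => x q c).
Proof. by move=> dq c; exact: csmooth_cdiff. Qed.

Let dG q : dom X i q -> forall a A B, cdiff X i q (fun q => sconn nab i q a A B).
Proof. by move=> dq a A B; apply: csmooth_cdiff => //; exact: sconn_smooth. Qed.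

Let dG' q : dom X i q -> forall a A B, cdiff X i q (fun q => sconn' nab i q a A B).
Proof. by move=> dq a A B; apply: csmooth_cdiff => //; exact: sconn'_smooth. Qed.

Let w2det q : dom X i q -> w q ^+ 2 * det2 (s q) = 1.
Proof.
move=> dq; have [w0 <-] := Om_det dq.
by rewrite -rmorphXn -rmorphM /= mulfV // expf_neq0 // gt_eqF.
Qed.

Let w5det q : dom X i q -> w q ^+ 5 * det2 (s q) = w q ^+ 3.
Proof. by move=> dq; rewrite (exprD _ 3 2) -mulrA w2det ?mulr1. Qed.

(** Sigma is a field on pairs of unprimed indices here, with the connection acting on both. The
    curvature produces the coefficient Omega^5 det sigma, which [w5det] turns into Omega^3. *)
Lemma xi_gradient q : dom X i q ->
  (forall A' B', chi q A' B' = chi q B' A') /\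
  forall a b, nabla_v nab i x q a b = dxi (s q) (chi q) (hu q) a b.
Proof.
move=> dq.
pose V q (c : vidx) := s q c.1 c.2.
pose G2 q := vconn (sconn nab i q) (sconn nab i q).
have cV a c q' : dom X i q' -> covd e G2 V i a c q' = dsigma (x q') a c.1 c.2.
  move=> dq'; rewrite -(s_killing dq') /covd /V /nabla_s /G2; congr (_ - _).
  rewrite big_vidx big_I2 /vconn.
  by elim/vidx_ind: c; rewrite /= ?eqxx ?eq01; ring.
have DcV a b c : D a (covd e G2 V i b c) q
   = eps b.1 c.1 * D a (fun q => x q (c.2, b.2)) q
     + eps b.1 c.2 * D a (fun q => x q (c.1, b.2)) q.
  rewrite (eq_fderiv e a dq (cV b c)) /dsigma fderivD; try by apply: cdiffZ; exact: dx.
  by rewrite !fderivZ //; exact: dx.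
pose N := nabla_v nab i x q.
have H a b E F : eps b.1 E * N a (F, b.2) + eps b.1 F * N a (E, b.2)
     - (eps a.1 E * N b (F, a.2) + eps a.1 F * N b (E, a.2))
     = - (eps a.2 b.2 * (w q ^+ 5 * det2 (s q)) *
          (eps a.1 E * s q b.1 F + eps b.1 E * s q a.1 F
           + eps a.1 F * s q b.1 E + eps b.1 F * s q a.1 E) / 2%:R).
  have ric := ricci_identity nab a b (E, F)
     (fun a c d => cdiff_vconn a c d (dG dq) (dG dq)) (fun c => s_smooth c.1 c.2) dq.
  move: ric; rewrite -/V -/G2 !DcV.
  under eq_bigr => d _ do rewrite cV //.
  under [X in _ - (_ - X)]eq_bigr => d _ do rewrite cV //.
  under [X in _ - X = _]eq_bigr => d _ do rewrite cV // /tors mulrBl.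
  rewrite sumrB => ric.
  have h1 := leibniz_dsigma nab a b (E, F) (x q) (fun c => D a (fun q => x q c) q) dq.
  have h2 := leibniz_dsigma nab b a (E, F) (x q) (fun c => D b (fun q => x q c) q) dq.
  have K : \sum_d curv nab G2 i q a b (E, F) d * V q d
     = w q ^+ 5 / 2%:R * eps a.2 b.2 * det2 (s q) *
       (eps a.1 E * s q b.1 F + eps b.1 E * s q a.1 F
           + eps a.1 F * s q b.1 E + eps b.1 F * s q a.1 E).
    have h := weyl_end_sigma (sC dq) a.1 b.1 E F.
    apply: (lincomb (scale_eq (- (w q ^+ 5 / 2%:R * eps a.2 b.2)) h)).
    under eq_bigr => d _ do
      rewrite (curv_vconn nab a b (E, F) d (dG dq) (dG dq) dq) !s_curv //.
    rewrite big_vidx !big_I2 /V /=.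
    by elim/I2_ind: E {h h1 h2 ric}; elim/I2_ind: F; rewrite /= ?eqxx ?eq01 /=; ring.
  rewrite K in ric.
  rewrite /N /nabla_v; rewrite /G2 /= in ric h1 h2.
  apply: (lincomb (add_eq ric (add_eq (scale_eq (-1) h1) h2))).
  ring.
have [chiC NE] := killing_spinor_gradient (sC dq) H.
split=> // a b; rewrite -/(N a b) NE /dxi w5det // -/(chi q _ _); ring.
Qed.

Lemma fderiv_s q a A B : dom X i q ->
  D a (fun q => s q A B) q = dsigma (x q) a A B
    + \sum_(E < 2) (sconn nab i q a A E * s q E B + sconn nab i q a B E * s q A E).
Proof. by move=> dq; rewrite -(s_killing dq) /nabla_s subrK. Qed.

Lemma cdiff_det q : dom X i q -> cdiff X i q (fun q => det2 (s q)).
Proof. by move=> dq; apply: cdiffB; apply: cdiffM; exact: ds. Qed.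

Lemma fderiv_det q a : dom X i q ->
  D a (fun q => det2 (s q)) q = ddet (s q) (x q) a.
Proof.
move=> dq; rewrite fderivB //; try by apply: cdiffM; exact: ds.
rewrite !fderivM //; try exact: ds.
rewrite !fderiv_s // !big_I2 (sconn_trace nab _ dq) /ddet /dsigma /= (sC dq i1 i0).
ring.
Qed.

Lemma cdiff_Om q : dom X i q -> cdiff X i q (fun q => w q).
Proof. by move=> dq; have [] := fderiv_inv_sqrt e (i0, i0) Om_det (cdiff_det dq) dq. Qed.

Lemma fderiv_Om q a : dom X i q ->
  D a (fun q => w q) q = - (hu q * ddet (s q) (x q) a).
Proof.
move=> dq; have [_ ->] := fderiv_inv_sqrt e a Om_det (cdiff_det dq) dq.
by rewrite fderiv_det.
Qed.

Lemma cdiff_hu q : dom X i q -> cdiff X i q (fun q => hu q).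
Proof.
move=> dq; rewrite (_ : (fun q => hu q) = fun q => 2%:R^-1 * (w q * (w q * w q))).
  apply: cdiffZ; apply: cdiffM; first exact: cdiff_Om.
  by apply: cdiffM; exact: cdiff_Om.
by apply/funext => q'; ring.
Qed.

(** The coefficient is 3/2 w^2, from the cube, times w^3 / 2, from [fderiv_Om]. *)
Lemma fderiv_hu q a : dom X i q ->
  D a (fun q => hu q) q = - (3%:R / 4%:R * w q ^+ 5 * ddet (s q) (x q) a).
Proof.
move=> dq; have dw := cdiff_Om dq.
rewrite (_ : (fun q => hu q) = fun q => 2%:R^-1 * (w q * (w q * w q))); last first.
  by apply/funext => q'; ring.
rewrite fderivZ // ?fderivM // ?fderiv_Om //; try by repeat apply: cdiffM.
by field.
Qed.

Lemma cdiff_nabla_x q a b : dom X i q -> cdiff X i q (fun q => nabla_v nab i x q a b).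
Proof.
move=> dq; apply: cdiffB; first exact: cdiff_fderiv.
apply: cdiff_sum => c; apply: cdiffM; last exact: dx.
by apply: cdiff_vconn; [exact: dG|exact: dG'].
Qed.

Lemma cdiff_chi q A' B' : dom X i q -> cdiff X i q (fun q => chi q A' B').
Proof.
move=> dq; apply: cdiffM; last exact: cdiff_cst.
apply: cdiff_sum => A; apply: cdiff_sum => B; apply: cdiffZ.
exact: cdiff_nabla_x.
Qed.

(** In the Ricci identity for xi the gradient of Omega^3 sigma absorbs the Weyl term ([weyl_end_xi])
    and the primed curvature is 0; what remains is the hypothesis of [sd_gradient_eq0] for P = nabla
    chi. *)
Lemma chi_parallel q a A' B' : dom X i q ->
  D a (fun q => chi q A' B') q
  = \sum_(E < 2) (sconn' nab i q a A' E * chi q E B'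
                   + sconn' nab i q a B' E * chi q A' E).
Proof.
move=> dq.
have chiC q' (dq' : dom X i q') := (xi_gradient dq').1.
pose P a A' B' := D a (fun q => chi q A' B') q
  - \sum_(E < 2) (sconn' nab i q a A' E * chi q E B'
                  + sconn' nab i q a B' E * chi q A' E).
have PC a' A B : P a' A B = P a' B A.
  rewrite /P (eq_fderiv e a' dq (fun q' dq' => chiC q' dq' A B)); congr (_ - _).
  by apply: eq_bigr => E _; rewrite (chiC q dq E B) (chiC q dq A E); ring.
suff : P a A' B' = 0 by move=> /eqP; rewrite subr_eq0 => /eqP.
apply: sd_gradient_eq0 => {a A' B'} // a b F F'.
pose L q' b c := dxi (s q') (chi q') (hu q') b c.
have cV a' c q' : dom X i q' -> covd e (gam nab i) x i a' c q' = L q' a' c.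
  by move=> dq'; exact: (xi_gradient dq').2 a' c.
have DcV a' b' c' : D a' (covd e (gam nab i) x i b' c') q
   = eps b'.1 c'.1 * D a' (fun q => chi q b'.2 c'.2) q
     - (hu q * D a' (fun q => s q b'.1 c'.1) q
        - 3%:R / 4%:R * w q ^+ 5 * ddet (s q) (x q) a' * s q b'.1 c'.1)
       * eps b'.2 c'.2.
  have dus : cdiff X i q (fun q => hu q * s q b'.1 c'.1).
    by apply: cdiffM; [exact: cdiff_hu|exact: ds].
  have dc := cdiff_chi b'.2 c'.2 dq.
  rewrite (eq_fderiv e a' dq (cV b' c')) /L /dxi fderivB //; last first.
  - by apply: cdiffM => //; exact: cdiff_cst.
  - exact: cdiffZ.
  rewrite fderivZ // (fderivM e a' dq dus (cdiff_cst i q (eps b'.2 c'.2))).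
  rewrite fderiv_cst mulr0 add0r (fderivM e a' dq (cdiff_hu dq)); last exact: ds.
  by rewrite (fderiv_hu a' dq) mulNr.
have dA a' c d : cdiff X i q (fun q => gam nab i q a' c d).
  by apply: cdiff_vconn; [exact: dG|exact: dG'].
have ric := ricci_identity nab a b (F, F') dA x_smooth dq.
move: ric; rewrite !DcV.
under eq_bigr => d _ do rewrite cV //.
under [X in _ - (_ - X)]eq_bigr => d _ do rewrite cV //.
under [X in _ - X = _]eq_bigr => d _ do rewrite cV // /tors mulrBl.
rewrite sumrB => ric.
have h1 := leibniz_dxi nab a b (F, F') (fun A B => D a (fun q => s q A B) q)
  (fun A B => D a (fun q => chi q A B) q) (hu q)
  (- (3%:R / 4%:R * w q ^+ 5 * ddet (s q) (x q) a)) (sC dq) (chiC q dq) dq.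
have h2 := leibniz_dxi nab b a (F, F') (fun A B => D b (fun q => s q A B) q)
  (fun A B => D b (fun q => chi q A B) q) (hu q)
  (- (3%:R / 4%:R * w q ^+ 5 * ddet (s q) (x q) b)) (sC dq) (chiC q dq) dq.
have K : \sum_d curv nab (gam nab i) i q a b (F, F') d * x q d
   = - (w q ^+ 5 / 2%:R * eps a.2 b.2 *
     \sum_(f < 2) weyl_end (fun A B D E =>
        s q A B * s q D E + s q A D * s q B E + s q A E * s q B D) a.1 b.1 F f
       * x q (f, F')).
  under eq_bigr => d _ do
    rewrite (curv_vconn nab a b (F, F') d (dG dq) (dG' dq) dq) curv'0 // s_curv //.
  rewrite big_vidx big_I2 /=.
  by elim/I2_ind: F' {h1 h2 ric}; rewrite /= ?eqxx ?eq01 /=; ring.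
rewrite K in ric.
have S (a' : vidx) A B : D a' (fun q => s q A B) q
   - \sum_(E < 2) (sconn nab i q a' A E * s q E B + sconn nab i q a' B E * s q A E)
   = dsigma (x q) a' A B by rewrite fderiv_s // addrK.
rewrite /= (S a b.1 F) in h1; rewrite /= (S b a.1 F) in h2; rewrite /= in ric.
have h3 := weyl_end_xi (x q) (sC dq) a b (F, F').
(* Replacing w^3 by w^5 det sigma gives the gradient of Omega^3 sigma and the Weyl term a common
   factor w^5, so that [h3] scaled by w^5 / 4 matches them. *)
have w5 := w5det dq.
apply: (lincomb (add_eq (add_eq ric (add_eq (scale_eq (-1) h1) h2))
  (scale_eq (w q ^+ 5 / 4%:R) h3))).
rewrite /P /L /= -w5.
by field.
Qed.

Lemma fderiv_vdot q a : dom X i q ->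
  D a (fun q => vdot (x q) (x q)) q
  = 2%:R * \sum_b vraise (x q) b * nabla_v nab i x q a b.
Proof.
move=> dq; have dr c : cdiff X i q (fun q => vraise (x q) c).
  by apply: cdiff_vraise => b; exact: dx.
rewrite fderiv_sum; last by move=> c; apply: cdiffM => //; exact: dx.
under eq_bigr => c _ do
  rewrite (fderivM e a dq (dx dq c) (dr c)) (fderiv_vraise e a c dq (dx dq)).
rewrite /nabla_v !big_vidx !vraiseE /gam /vconn /=.
rewrite !(sconn_trace nab _ dq, sconn'_trace nab _ dq); ring.
Qed.

Definition Hten q b c : C :=
  s q b.1 c.1 * chi q b.2 c.2 - (w q + vdot (x q) (x q)) / 2%:R * geps b c.

Lemma halfEE q : dom X i q ->
  (w q + vdot (x q) (x q)) / 2%:R = halfE (s q) (x q) (hu q).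
Proof.
move=> dq; have h := w2det dq.
rewrite /halfE /vdot big_vidx !vraiseE.
apply: (lincomb (scale_eq (- (w q / 2%:R)) h)); by field.
Qed.

Lemma HtenE q b c : dom X i q -> Hten q b c = Hs (s q) (chi q) (x q) (hu q) b c.
Proof. by move=> dq; rewrite /Hten halfEE. Qed.

Let dvdot q : dom X i q -> cdiff X i q (fun q => vdot (x q) (x q)).
Proof.
move=> dq; apply: cdiff_sum => c; apply: cdiffM; first exact: csmooth_cdiff.
by apply: cdiff_vraise => b; exact: csmooth_cdiff.
Qed.

Lemma fderiv_halfE q a : dom X i q ->
  D a (fun q => (w q + vdot (x q) (x q)) / 2%:R) q = halfdE (chi q) (x q) a.
Proof.
move=> dq.
have dE : cdiff X i q (fun q => w q + vdot (x q) (x q)).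
  by apply: cdiffD; [exact: cdiff_Om|exact: dvdot].
rewrite (fderivM e a dq dE (cdiff_cst i q (2%:R^-1))) fderiv_cst mulr0 add0r.
rewrite (fderivD e a (cdiff_Om dq) (dvdot dq)) fderiv_vdot //.
rewrite fderiv_Om //.
under eq_bigr => b _ do rewrite (xi_gradient dq).2.
by rewrite (halfdE_eq (chi q) (x q) (hu q) (sC dq)); field.
Qed.

Lemma cdiff_Hten q b c : dom X i q -> cdiff X i q (fun q => Hten q b c).
Proof.
move=> dq; apply: cdiffB.
  by apply: cdiffM; [exact: csmooth_cdiff|exact: cdiff_chi].
apply: cdiffM; last exact: cdiff_cst.
apply: cdiffM; last exact: cdiff_cst.
by apply: cdiffD; [exact: cdiff_Om|exact: dvdot].
Qed.

Lemma nabla_Hten q a b c : dom X i q ->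
  nabla_t nab i Hten q a b c = dH (chi q) (x q) a b c.
Proof.
move=> dq.
have dc A B : cdiff X i q (fun q => chi q A B) by exact: cdiff_chi.
have dE : cdiff X i q (fun q => (w q + vdot (x q) (x q)) / 2%:R).
  apply: cdiffM; last exact: cdiff_cst.
  by apply: cdiffD; [exact: cdiff_Om|exact: dvdot].
have E : D a (fun q => Hten q b c) q
   = D a (fun q => s q b.1 c.1) q * chi q b.2 c.2
     + s q b.1 c.1 * D a (fun q => chi q b.2 c.2) q
     - halfdE (chi q) (x q) a * geps b c.
  have d1 : cdiff X i q (fun q => s q b.1 c.1 * chi q b.2 c.2).
    by apply: cdiffM; [exact: ds|exact: dc].
  have d2 := cdiffM dE (cdiff_cst i q (geps b c)).
  rewrite /Hten (fderivB e a dq d1 d2) (fderivM e a dq (ds dq _ _) (dc _ _)).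
  rewrite (fderivM e a dq dE (cdiff_cst i q (geps b c))).
  rewrite fderiv_cst mulr0 add0r fderiv_halfE //; ring.
rewrite /nabla_t E.
have h := leibniz_H nab a b c (fun A B => D a (fun q => s q A B) q)
  (fun A B => D a (fun q => chi q A B) q) ((w q + vdot (x q) (x q)) / 2%:R)
  (halfdE (chi q) (x q) a) (sC dq) (xi_gradient dq).1 dq.
apply: etrans h _.
(* With chi parallel, only the gradients of sigma and of E_+ survive. *)
rewrite (chi_parallel a b.2 c.2 dq) subrr mulr0 addr0.
by rewrite -[X in X * chi q _ _]/(nabla_s nab i s q a b.1 c.1) s_killing.
Qed.

Definition tvec q b : C := \sum_c Hten q b c * vraise (x q) c.

Lemma nabla_tvec q a b : dom X i q ->
  nabla_v nab i tvec q a b = dt (s q) (chi q) (x q) (hu q) a b.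
Proof.
move=> dq; rewrite nabla_v_contract //.
- apply: eq_bigr => c _; rewrite nabla_Hten // HtenE //; congr (_ + _ * _).
  by apply: eq_bigr => d _; rewrite (xi_gradient dq).2.
- by move=> b' c'; exact: cdiff_Hten.
- by move=> c; exact: csmooth_cdiff.
Qed.

Lemma tvecE q b : dom X i q -> tvec q b = ts (s q) (chi q) (x q) (hu q) b.
Proof. by move=> dq; apply: eq_bigr => c _; rewrite HtenE. Qed.

Lemma Hten_killing q a b c : dom X i q -> vsym3 (nabla_t nab i Hten q) a b c = 0.
Proof.
move=> dq; rewrite /vsym3 /vsym2 !nabla_Hten // -!mulrDl.
by rewrite (H_killing (x q) (xi_gradient dq).1) !mul0r.
Qed.

Lemma tvec_killing q a b : dom X i q -> vsym2 (nabla_v nab i tvec q) a b = 0.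
Proof.
move=> dq; rewrite /vsym2 !nabla_tvec //.
by rewrite (t_killing (x q) (hu q) (sC dq) (xi_gradient dq).1) mul0r.
Qed.

Lemma tvec_asd q A' B' : dom X i q ->
  \sum_(A < 2) \sum_(B < 2) eps A B * nabla_v nab i tvec q (A, A') (B, B') = 0.
Proof.
move=> dq; apply: etrans (t_asd (x q) (hu q) (sC dq) (xi_gradient dq).1 A' B').
by apply: eq_bigr => A _; apply: eq_bigr => B _; rewrite nabla_tvec.
Qed.

Lemma tvec_bracket q m : dom X i q ->
  lie_bracket X i (vec_coord e i tvec) (vec_coord e i x) q m = 0.
Proof.
move=> dq; rewrite (lie_bracket_vec_coord nab) //; last first.
- by move=> c; exact: csmooth_cdiff.
- move=> b; apply: cdiff_sum => c; apply: cdiffM; first exact: cdiff_Hten.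
  by apply: cdiff_vraise => d; exact: csmooth_cdiff.
apply: big1 => c _; rewrite [X in X * _](_ : _ = 0) ?mul0r //.
apply: big1 => b _; rewrite [X in _ * X](_ : _ = 0) ?mulr0 //.
apply: etrans (t_commutes (x q) (hu q) (sC dq) (xi_gradient dq).1 b).
apply: eq_bigr => a _; rewrite nabla_tvec // (xi_gradient dq).2; congr (_ * _ - _).
by apply: eq_bigr => d _; rewrite tvecE.
Qed.

End KillingSpinor.

Theorem proposition6 (R : realType) (M : topologicalType)
  (M_hausdorff : hausdorff_space M) (M_countable : @second_countable M)
  (X : atlas R M) (g : metric X) (e : spin_frames g)
  (nab : spin_connection e)
  (M_hyperkahler : hyperkahler nab)
  (M_nonflat : exists i p a b c d, dom X i p /\ riemann nab i p a b c d <> 0)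
  (M_ricci_flat : forall i p, dom X i p -> forall a b, ricci nab i p a b = 0)
  (M_sd_flat : forall i p, dom X i p ->
     forall A' B' C' D', Weyl_sd nab i p A' B' C' D' = 0)
  (sigma : cindex X -> M -> 'I_2 -> 'I_2 -> R[i])
  (xi : cindex X -> M -> 'I_2 * 'I_2 -> R[i])
  (Om : M -> R)
  (sigma_field : real_spinor_field e sigma)
  (xi_field : real_vector_field e xi)
  (sigma_killing : killing_spinor nab sigma xi)
  (Om_factor : conformal_factor sigma Om)
  (sigma_normalised : type_D_normalised nab sigma Om)
  (xi_nonzero : exists i p a, dom X i p /\ xi i p a <> 0)
  (xi_not_asd : exists i p A' B', dom X i p /\ chi_of nab xi i p A' B' <> 0) :
  forall (i : cindex X) (p : M), dom X i p ->
  let H := Htensor nab sigma Om xi in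
  let t := tvector nab sigma Om xi in
  [/\ forall a b c, vsym3 (nabla_t nab i (H i) p) a b c = 0,
      forall a b, vsym2 (nabla_v nab i (t i) p) a b = 0,
      forall A' B' : 'I_2,
        \sum_(A < 2) \sum_(B < 2)
          eps A B * nabla_v nab i (t i) p (A, A') (B, B') = 0 &
      forall m : 'I_4,
        lie_bracket X i (vec_coord e i (t i)) (vec_coord e i (xi i)) p m = 0].
Proof.
move=> i p dp H t.
have [/(_ i) s_smooth _ _] := sigma_field; have [/(_ i) x_smooth _ _] := xi_field.
have sC q (dq : dom X i q) := (sigma_killing i q dq).1.
have s_killing q : dom X i q -> forall a B D,
    nabla_s nab i (sigma i) q a B D = dsigma (xi i q) a B D.
  move=> dq a B D; rewrite (sigma_killing i q dq).2 /dsigma /sym2; by field.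
have Om_det q : dom X i q -> 0 < Om q /\ ((Om q) ^- 2)%:C = det2 (sigma i q).
  move=> dq; have [w0 E] := Om_factor i q dq; split=> //.
  by rewrite E snorm2E; field.
have curv'0 q : dom X i q -> forall a b A f,
    curv nab (sconn' nab i) i q a b A f = 0.
  by move=> dq a b A f; exact: hyperkahler_curv'.
have s_curv q : dom X i q -> forall a b A f,
  curv nab (sconn nab i) i q a b A f
  = - ((Om q)%:C ^+ 5 / 2%:R * eps a.2 b.2 * weyl_end (fun A B D E =>
        sigma i q A B * sigma i q D E + sigma i q A D * sigma i q B E
        + sigma i q A E * sigma i q B D) a.1 b.1 A f).
  (* The principal spinor [k] belongs to the single point q and disappears in [WE]. *)
  move=> dq a b A f; have [k [_ psi so]] := sigma_normalised i q dq.
  have w0 : (Om q)%:C != 0.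
    by rewrite eq_complex /= eqxx andbT gt_eqF //; have [] := Om_det q dq.
  have so' A' B' : sigma i q A' B' = 2%:R * 'i%C * ((Om q)%:C)^-1
      * sym2 (fun F G => k F * dag1 k G) A' B'.
    by rewrite so fmorphV.
  have W B D := ricci_flat_spin_curv a b B D M_hyperkahler (M_ricci_flat i q dq) dq.
  have WE B D E F : Weyl_asd nab i q B D E F = - ((Om q)%:C ^+ 5 *
      (sigma i q B D * sigma i q E F + sigma i q B E * sigma i q D F
       + sigma i q B F * sigma i q D E) / 2%:R).
    by rewrite psi rmorphXn; exact: type_D_weyl w0 so'.
  have S B D := etrans (W B D) (f_equal ( *%R _) (WE _ _ B D)).
  (* Undoes the lowering by eps: upper component 0 is lower component 1, and upper component 1 is
     minus lower component 0. *)
  elim/I2_ind: f; rewrite /weyl_end /=.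
    by rewrite -(spin_curvE nab i q a b A).2 S; field.
  by rewrite -[LHS]opprK -(spin_curvE nab i q a b A).1 S; field.
have HE : H i = Hten nab i (sigma i) (xi i) Om by [].
have tE : t i = tvec nab i (sigma i) (xi i) Om by [].
rewrite HE tE; split.
- move=> a b c.
  exact (Hten_killing s_smooth x_smooth sC s_killing Om_det s_curv curv'0 a b c dp).
- move=> a b.
  exact (tvec_killing s_smooth x_smooth sC s_killing Om_det s_curv curv'0 a b dp).
- move=> A' B'.
  exact (tvec_asd s_smooth x_smooth sC s_killing Om_det s_curv curv'0 A' B' dp).
- move=> m.
  exact (tvec_bracket s_smooth x_smooth sC s_killing Om_det s_curv curv'0 m dp).
Qed.
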